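(* Let $0<p\le 1$ and $\sigma_j=j^{-\lambda}$, $j\in\mathbb{N}$, for some $\lambda>0$. Then there exist constants $c,C,D>0$ such that, for all $m\in\mathbb{N}$ and all $1\le n<m$ with $n\ge D\log(\mathrm{e}m/n)$, we have \[ \mathrm{rad}(\mathcal{E}_{p,\sigma}^m,E_n^{\mathrm{ran}})\le C\Big(\frac{\log(\mathrm{e}m/n)}{n}\Big)^{\lambda+1/p-1/2} \] with probability at least $1-2\exp(-c\,n)$.
   Context: The $m$-dimensional $\ell_p$-ellipsoid is $\mathcal{E}_{p,\sigma}^m=\{x\in\mathbb{R}^m:\sum_{i=1}^m |x_i|^p/\sigma_i^p\le 1\}$. For $K\subset\mathbb{R}^m$ and a linear subspace $E\subset\mathbb{R}^m$, $\mathrm{rad}(K,E)=\sup_{x\in K\cap E}\|x\|_2$. $E_n^{\mathrm{ran}}$ is a random linear subspace of $\mathbb{R}^m$ of codimension $n$, distributed according to the rotation invariant probability measure on the Grassmannian of $(m-n)$-dimensional subspaces; equivalently, $E_n^{\mathrm{ran}}=\ker G_{n,m}$ where $G_{n,m}$ is an $n\times m$ matrix with independent standard Gaussian entries. $\log$ is the natural logarithm. The constants may depend on $p$ and $\lambda$ but not on $m,n$. *)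

(* Defs.v *)
From HB Require Import structures.
From mathcomp Require Import all_boot all_order all_algebra.
From mathcomp Require Import all_classical all_reals all_analysis.
Set Implicit Arguments.
Unset Strict Implicit.
Unset Printing Implicit Defensive.
Import Order.TTheory GRing.Theory Num.Theory.
Import numFieldNormedType.Exports.
Local Open Scope classical_set_scope.
Local Open Scope ring_scope.

Definition norm2 (R : realType) (m : nat) (x : 'cV[R]_m) : R :=
  Num.sqrt (\sum_(i < m) (x i 0) ^+ 2).

(* Coordinates are numbered 0, ..., m - 1 while the semiaxes are sigma 1, sigma 2,
   and so on, hence the shift; sigma 0 is never used. *)
Definition ellipsoid (R : realType) (p : R) (sigma : nat -> R) (m : nat) :
    set 'cV[R]_m :=
  [set x | \sum_(i < m) `|x i 0| `^ p / sigma i.+1 `^ p <= 1].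
Arguments ellipsoid {R} p sigma m _.

(* The supremum is taken in the extended reals, because sup is 0 on
   unbounded sets of reals. *)
Definition l2_rad (R : realType) (m : nat) (K : set 'cV[R]_m)
    (E : {vspace 'cV[R]_m}) : \bar R :=
  ereal_sup [set (norm2 x)%:E | x in K `&` [set` E]].

Definition mutually_independent d (T : measurableType d) (R : realType)
    (P : probability T R) (I : finType) (X : I -> {RV P >-> R}) : Prop :=
  forall (J : {set I}) (B : I -> set R), (forall i, measurable (B i)) ->
    P (\bigcap_(i in [set` J]) (X i @^-1` B i)) =
    (\prod_(i in J) P (X i @^-1` B i))%E.

(* normal_prob takes the mean and the standard deviation. *)
Definition standard_normal d (T : measurableType d) (R : realType)
    (P : probability T R) (X : {RV P >-> R}) : Prop :=
  forall A : set R, measurable A -> distribution P X A = normal_prob 0 1 A.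

Definition gaussian_matrix d (T : measurableType d) (R : realType)
    (P : probability T R) (n m : nat) (g : 'I_n * 'I_m -> {RV P >-> R}) : Prop :=
  mutually_independent g /\ forall ij, standard_normal (g ij).

(* If g is a Gaussian matrix, this is the random subspace of codimension n with
   the rotation invariant law on the Grassmannian; the codimension is n almost
   surely. *)
Definition random_kernel d (T : measurableType d) (R : realType)
    (P : probability T R) (n m : nat) (g : 'I_n * 'I_m -> {RV P >-> R}) (w : T) :
    {vspace 'cV[R]_m} :=
  let G : 'M[R]_(n, m) := \matrix_(i, j) g (i, j) w in
  lker (linfun (fun x : 'cV[R]_m => G *m x)).

(* Main.v *)
Require Import Defs.
From HB Require Import structures.
From mathcomp Require Import all_boot all_order all_algebra.
From mathcomp Require Import all_classical all_reals all_analysis.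
From mathcomp Require Import measurable_realfun ring lra.
Import Order.TTheory GRing.Theory Num.Theory.
Import numFieldNormedType.Exports.
Local Open Scope classical_set_scope.
Local Open Scope ring_scope.
Set Implicit Arguments.
Unset Strict Implicit.
Unset Printing Implicit Defensive.

(** Let l = ln (e m / n), let s be a small multiple of n / l, and put
    h = s ^ (- lambda - 1 / p), so that h * sqrt s is of the order of the
    announced bound. A point x of the ellipsoid satisfies
      \sum_(i >= s) |x_i| ^ p <= s * h ^ p        ([ellipsoid_tail]),
    and the claim is that, with high probability, no such x with G x = 0 has a
    norm above 7 * h * sqrt s.

    For a fixed G this follows from a two-sided estimate of |G z| on integer
    vectors z only ([kernel_section_gap]). The ellipsoid is star-shaped, so a
    point of too large norm can be shrunk to a point y with |y|^2 = 49 s h^2.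
    Rounding the coordinates of y / h towards zero gives y = h (k + r) with k an
    integer vector, |k|^2 <= 49 s, and with r in the cube [-1, 1]^m such that
    \sum |r_i| <= 2 s; the hypothesis p <= 1 enters here, through
    |r_i| <= |r_i| ^ p. Such an r is a convex combination of vectors with entries
    -1, 0, 1 of which at most 2 s are nonzero ([le_box_extreme]), and these are
    integer vectors again. If
      a |z|^2 < |G z|^2 < 12 a |z|^2
    for all nonzero integer z with |z|^2 <= 49 s, then convexity gives
    |G r|^2 <= 24 a s, while |k|^2 >= 30 s gives |G k|^2 > 30 a s. This
    contradicts G k = - G r.

    For a Gaussian G and a fixed z, the coordinates of G z / |z| are independent
    and standard normal, hence the Laplace transform of |G z|^2 / |z|^2 at t is
    (1 + 2 t) ^ (- n / 2) ([sqnorm_gaussian_laplace]). Its values at t = 3/2 and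
    t = - 3/8 show that z violates the estimate above, with a = (ln 2 / 3) n, with
    probability at most 2 * 2 ^ (- n / 2). There are at most
    theta ^ (- N) * exp (4 theta m) integer vectors with |z|^2 <= N
    ([card_int_net]); for N = 49 s and theta a small multiple of n / m this is at
    most 2 ^ (n / 4) by the choice of s ([sparsity_level]). The union bound
    leaves the failure probability 2 * 2 ^ (- n / 4).

    The norm exceeds b on the section exactly when the kernel meets one of
    countably many compact sets, and for each of them this is an event
    ([measurable_kernel_meets_compact]). *)

(** * Squared Euclidean norm *)

Section squared_norm.
Context {R : realType}.

Definition sqnorm {m : nat} (x : 'cV[R]_m) : R := \sum_(i < m) x i 0 ^+ 2.

Lemma sqnormZ m (c : R) (x : 'cV[R]_m) : sqnorm (c *: x) = c ^+ 2 * sqnorm x.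
Proof. by rewrite /sqnorm mulr_sumr; apply: eq_bigr => i _; rewrite mxE exprMn. Qed.

Lemma sqnormN m (x : 'cV[R]_m) : sqnorm (- x) = sqnorm x.
Proof. by apply: eq_bigr => i _; rewrite mxE sqrrN. Qed.

Lemma sqnorm_ge0 m (x : 'cV[R]_m) : 0 <= sqnorm x.
Proof. by apply: sumr_ge0 => i _; exact: sqr_ge0. Qed.

Lemma sqnorm_gt0 m (x : 'cV[R]_m) : x != 0 -> 0 < sqnorm x.
Proof.
move=> x0; rewrite lt0r sqnorm_ge0 andbT; apply: contra x0 => /eqP s0.
apply/eqP/colP => i; rewrite mxE; apply/eqP; rewrite -sqrf_eq0.
have /psumr_eq0P := s0; move=> /(_ (fun i _ => sqr_ge0 _)) -> //.
Qed.

Lemma quasiconvex_sqnorm n m (G : 'M[R]_(n, m)) (x y : 'cV[R]_m) (t : R) :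
  0 <= t -> t <= 1 ->
  sqnorm (G *m (t *: x + (1 - t) *: y)) <=
  Num.max (sqnorm (G *m x)) (sqnorm (G *m y)).
Proof.
move=> t0 t1; rewrite mulmxDr -!scalemxAr.
move: (G *m x) (G *m y) => u v.
apply: (@le_trans _ _ (t * sqnorm u + (1 - t) * sqnorm v)).
  rewrite /sqnorm !mulr_sumr -big_split/=; apply: ler_sum => i _; rewrite !mxE.
  have : 0 <= t * (1 - t) * (u i 0 - v i 0) ^+ 2.
    by rewrite mulr_ge0 ?sqr_ge0// mulr_ge0// subr_ge0.
  nra.
set S := Num.max _ _.
have uS : sqnorm u <= S by rewrite le_max lexx.
have vS : sqnorm v <= S by rewrite le_max lexx orbT.
nra.
Qed.

End squared_norm.

(** * A Gaussian integral *)

Section gaussian_integral.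
Context {R : realType}.
Local Notation mu := (@lebesgue_measure R).
Implicit Types (t k c : R).

(** The Radon-Nikodym theorem gives this for functions of finite integral. The
    general case is needed for the exponentials of squares below, which are not
    known to be integrable in advance; it is reached by truncating f. *)
Lemma ge0_integral_normal_prob (m s : R) (f : R -> R) : s != 0 ->
  measurable_fun setT f -> (forall x, 0 <= f x) ->
  (\int[normal_prob m s]_x (f x)%:E =
   \int[mu]_x ((f x)%:E * (normal_pdf m s x)%:E))%E.
Proof.
move=> s0 mf f0.
have dom := normal_prob_dominates m s.
pose g n x := Num.min (f x) n%:R.
have g0 n x : 0 <= g n x by rewrite /g le_min f0 ler0n.
have mg n : measurable_fun setT (g n).
  by apply: measurable_minr => //; exact: measurable_cst.
have mgE n : measurable_fun setT (EFin \o g n) by exact/measurable_EFinP.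
have mpdf : measurable_fun setT (EFin \o normal_pdf m s).
  by apply/measurable_EFinP; exact: measurable_normal_pdf.
have ndg x : {homo g^~ x : a b / (a <= b)%N >-> a <= b}.
  by move=> a b ab; rewrite /g le_min ge_min lexx /= ge_min ler_nat ab orbT.
have cvgg x : (EFin \o g^~ x) @ \oo --> (f x)%:E.
  apply: cvg_EFin; first by near=> n.
  apply: cvg_near_cst; near=> n; rewrite /= /g.
  apply/min_idPl; near: n; exact: nbhs_infty_ger.
have step n : (\int[normal_prob m s]_x (g n x)%:E =
   \int[mu]_x ((g n x)%:E * (normal_pdf m s x)%:E))%E.
  rewrite -(Radon_Nikodym_change_of_variables dom)//=; last first.
    apply: (@le_integrable _ _ _ _ _ _ _ (EFin \o cst n%:R)) => //.
    + by apply/measurable_EFinP; exact: mg.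
    + by move=> x _; rewrite /= lee_fin !ger0_norm// /g ge_min lexx orbT.
    + by apply: finite_measure_integrable_cst.
  apply: ae_eq_integral => //.
  - apply: emeasurable_funM; first exact: mgE.
    by apply: (measurable_int mu); exact: Radon_Nikodym_integrable.
  - by apply: emeasurable_funM; [exact: mgE|exact: mpdf].
  - apply: ae_eqe_mul2l => /=.
    rewrite Radon_NikodymE//=.
    case: cid => /= h [h1 h2 h3].
    apply: integral_ae_eq => //=.
    by move=> E E01 mE; rewrite -h3.
transitivity (limn (fun n => \int[normal_prob m s]_x (g n x)%:E)%E).
  rewrite -monotone_convergence//=.
  - by apply: eq_integral => x _; apply/esym/cvg_lim => //; exact: cvgg.
  - by move=> n x _; rewrite lee_fin.
  - by move=> x _ a b ab; rewrite lee_fin ndg.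
transitivity (limn (fun n => \int[mu]_x ((g n x)%:E * (normal_pdf m s x)%:E))%E).
  by congr (limn _); apply/funext => n.
rewrite -monotone_convergence//=.
- apply: eq_integral => x _; apply/cvg_lim => //.
  by apply: cvgeZr => //; exact: cvgg.
- by move=> n; apply: emeasurable_funM; [exact: mgE|exact: mpdf].
- by move=> n x _; rewrite -EFinM lee_fin mulr_ge0// normal_pdf_ge0.
- move=> x _ a b ab; rewrite -!EFinM lee_fin ler_wpM2r ?normal_pdf_ge0//.
  exact: ndg.
Unshelve. all: by end_near.
Qed.

(** Completing the square: the tilted standard normal density is, up to a
    constant, the density of another normal law. The constant is thus the
    integral of the left-hand side, without a change of variables. *)
Lemma normal_pdf_square k c t : let A := 1 + 2 * t * k ^+ 2 in 0 < A ->
  forall x : R, expR (- t * (k * x + c) ^+ 2) * normal_pdf 0 1 x =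
  (Num.sqrt A)^-1 * expR (- t * c ^+ 2 / A) *
    normal_pdf (- (2 * t * k * c) / A) (Num.sqrt A)^-1 x.
Proof.
move=> A A0 x.
have sA0 : 0 < Num.sqrt A by rewrite sqrtr_gt0.
have sAE : Num.sqrt A ^+ 2 = A by rewrite sqr_sqrtr// ltW.
rewrite !normal_pdfE ?oner_neq0 ?invr_eq0 ?gt_eqF// /normal_peak /normal_fun.
rewrite exprVn sAE expr1n mul1r subr0.
have -> : (Num.sqrt (A^-1 * pi *+ 2))^-1 = Num.sqrt A * (Num.sqrt (pi *+ 2))^-1.
  by rewrite -mulrnAr sqrtrM ?invr_ge0 ?ltW// sqrtrV ?ltW// invfM invrK.
rewrite mulrCA -expRD.
transitivity ((Num.sqrt (pi *+ 2))^-1 * (expR (- t * c ^+ 2 / A) *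
   expR (- (x - - (2 * t * k * c) / A) ^+ 2 / (A^-1 *+ 2)))); last first.
  have : Num.sqrt A != 0 by rewrite gt_eqF.
  have : Num.sqrt (pi *+ 2 : R) != 0 by rewrite gt_eqF// sqrtr_gt0 mulrn_wgt0// pi_gt0.
  by move: (Num.sqrt _) (Num.sqrt _) => u v u0 v0; field; rewrite u0.
congr (_ * _); rewrite -expRD; congr expR.
by rewrite /A; field; rewrite -/A gt_eqF.
Qed.

Lemma normal_laplace k c t : 0 < 1 + 2 * t * k ^+ 2 ->
  (\int[normal_prob 0 1]_x (expR (- t * (k * x + c) ^+ 2))%:E =
   ((Num.sqrt (1 + 2 * t * k ^+ 2))^-1 *
     expR (- t * c ^+ 2 / (1 + 2 * t * k ^+ 2)))%:E)%E.
Proof.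
move=> A0; rewrite ge0_integral_normal_prob ?oner_neq0//; last first.
  apply: (measurableT_comp (@measurable_expR R)); apply: measurable_funM => //.
  by apply: measurable_funX; apply: measurable_funD => //; exact: measurable_funM.
under eq_integral => x _ do rewrite -EFinM normal_pdf_square// EFinM.
rewrite ge0_integralZl//=.
- by rewrite integral_normal_pdf mule1.
- by apply/measurable_EFinP; exact: measurable_normal_pdf.
- by move=> x _; rewrite lee_fin normal_pdf_ge0.
Qed.

End gaussian_integral.

(** * Sums of independent random variables *)

Section independence.
Context d (T : measurableType d) (R : realType) (P : probability T R).
Local Open Scope ereal_scope.

(** Given E, the variables are independent and keep their laws. Carrying the event E
    along makes an induction on N possible: part of the family can be absorbed
    into E. *)
Definition indep_event (E : set T) (N : nat) (X : nat -> T -> R) :=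
  forall B : nat -> set R, (forall i, measurable (B i)) ->
    P (E `&` \big[setI/setT]_(i < N) (X i @^-1` B i)) =
    P E * \prod_(i < N) P (X i @^-1` B i).

Definition indep_family (N : nat) (X : nat -> T -> R) := indep_event setT N X.

Lemma preimage_measurable (f : T -> R) (B : set R) :
  measurable_fun setT f -> measurable B -> measurable (f @^-1` B).
Proof. by move=> mf mB; rewrite -[X in measurable X]setTI; exact: mf. Qed.

(** The last variable of the family is absorbed into the event. *)
Lemma indep_event_restrict E N X (B : set R) :
  (forall i, measurable_fun setT (X i)) -> measurable B ->
  indep_event E N.+1 X ->
  indep_event (E `&` X N @^-1` B) N X /\
    P (E `&` X N @^-1` B) = P E * P (X N @^-1` B).
Proof.
move=> mX mB iE.
have key (C : nat -> set R) : (forall i, measurable (C i)) ->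
    P (E `&` X N @^-1` B `&` \big[setI/setT]_(i < N) (X i @^-1` C i)) =
    P E * P (X N @^-1` B) * \prod_(i < N) P (X i @^-1` C i).
  move=> mC; pose D i := if i == N then B else C i.
  have mD i : measurable (D i) by rewrite /D; case: ifP.
  have DC (i : 'I_N) : D i = C i by rewrite /D ltn_eqF.
  have := iE _ mD; rewrite !big_ord_recr /= {2 4}/D eqxx.
  under eq_bigr do rewrite DC.
  under [in X in _ = X -> _]eq_bigr do rewrite DC.
  rewrite (setIC (\big[_/_]_(_ < _) _)) setIA => ->.
  by rewrite (muleC (\prod_(_ < _) _)) muleA.
have PE : P (E `&` X N @^-1` B) = P E * P (X N @^-1` B).
  have := key (fun=> setT) (fun=> measurableT).
  under eq_bigr do rewrite preimage_setT.
  under [in X in _ = X -> _]eq_bigr do rewrite preimage_setT probability_setT.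
  by rewrite !big1// ?setIT ?mule1.
by split=> // C mC; rewrite key// PE.
Qed.

Lemma indep_event_pred E N X :
  (forall i, measurable_fun setT (X i)) ->
  indep_event E N.+1 X -> indep_event E N X.
Proof.
move=> mX /(indep_event_restrict mX measurableT)[].
by rewrite preimage_setT setIT.
Qed.

(** The product rule on rectangles determines the joint law, also for the
    restriction of P to E: there the law of W is P E times its law under P. *)
Lemma indep_pair (W V : {mfun T >-> R}) (E : set T) : measurable E ->
  (forall A B, measurable A -> measurable B ->
     P (E `&` (W @^-1` A `&` V @^-1` B)) =
     P E * P (W @^-1` A) * P (V @^-1` B)) ->
  forall S : set (R * R), measurable S ->
  P (E `&` (fun w => (W w, V w)) @^-1` S) =
  P E * (distribution P W \x distribution P V) S.
Proof.
move=> mE hE S mS.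
have mWV : measurable_fun setT (fun w => (W w, V w)).
  by apply: measurable_fun_pair.
have finE : P E \is a fin_num by exact: fin_num_measure.
have PE0 : (0 <= fine (P E))%R by rewrite fine_ge0.
pose k : {nonneg R} := NngNum PE0.
pose m1 := mscale k (distribution P W).
pose m' := pushforward (mrestr P mE) (fun w => (W w, V w)).
have kE : (k%:num)%:E = P E by rewrite /= fineK.
have mm : forall A B, measurable A -> measurable B ->
    m' (A `*` B) = m1 A * distribution P V B.
  move=> A B mA mB; rewrite /m1 /mscale kE /distribution /pushforward -hE//.
  rewrite /m' /pushforward /mrestr setIC; congr (P (_ `&` _)).
have /(_ mWV) H := product_measure_unique mm mS.
transitivity (m' S); first by rewrite /m' /pushforward /mrestr setIC.
transitivity ((m1 \x distribution P V) S); first exact/esym.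
rewrite /product_measure1 ge0_integral_mscale//= ?kE//.
exact: measurable_fun_xsection.
Qed.

Let mfun_of (f : T -> R) (mf : measurable_fun setT f) : {mfun T >-> R} :=
  HB.pack f (isMeasurableFun.Build _ _ _ _ f mf).

Lemma indep_pair_fubini (W V : {mfun T >-> R}) :
  (forall A B, measurable A -> measurable B ->
     P (W @^-1` A `&` V @^-1` B) = P (W @^-1` A) * P (V @^-1` B)) ->
  forall h : R * R -> R, measurable_fun setT h -> (forall z, 0 <= h z)%R ->
  \int[P]_w (h (W w, V w))%:E = \int[P]_w \int[P]_w' (h (W w, V w'))%:E.
Proof.
move=> iWV h mh h0.
have mWV : measurable_fun setT (fun w => (W w, V w)).
  exact: measurable_fun_pair.
have mhE : measurable_fun setT (EFin \o h) by exact/measurable_EFinP.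
rewrite -(@ge0_integral_pushforward _ _ _ _ _ _ mWV P setT (EFin \o h))//; last first.
  by move=> z _; rewrite lee_fin.
rewrite (eq_measure_integral (distribution P W \x distribution P V)%E); last first.
  move=> A mA _; transitivity (P (setT `&` (fun w => (W w, V w)) @^-1` A)).
    by rewrite setTI.
  rewrite indep_pair//; first by rewrite probability_setT mul1e.
  by move=> C B mC mB; rewrite setTI iWV// probability_setT mul1e.
rewrite fubini_tonelli1//=.
rewrite /fubini_F ge0_integral_distribution//=.
- apply: eq_integral => w _ /=; rewrite ge0_integral_distribution//=.
  + by apply: measurableT_comp => //; apply: measurable_fun_pair2.
  + by move=> y; rewrite lee_fin.
- exact: (measurable_fun_fubini_tonelli_F (m2 := distribution P V) (EFin \o h)).
- by move=> y; apply: integral_ge0 => z _; rewrite lee_fin.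
Qed.

Section sums.
Variables (X : nat -> T -> R) (f : nat -> R -> R).
Hypotheses (mX : forall i, measurable_fun setT (X i))
  (mf : forall i, measurable_fun setT (f i)).

Definition fsum (N : nat) (w : T) : R := (\sum_(i < N) f i (X i w))%R.

Lemma measurable_fsum N : measurable_fun setT (fsum N).
Proof.
apply: measurable_sum => i; exact: measurableT_comp.
Qed.

(** A sum of functions of the variables is independent of E. In the step, the event
    that the last variable is in B is absorbed into E, and the induction
    hypothesis yields the product rule for the pair (partial sum, last variable). *)
Lemma indep_event_fsum N E : measurable E ->
  indep_family N X -> indep_event E N X ->
  forall A, measurable A ->
  P (E `&` fsum N @^-1` A) = P E * P (fsum N @^-1` A).
Proof.
elim: N E => [|N IH] E mE iT iE A mA.
  rewrite /fsum; under eq_fun do rewrite big_ord0.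
  have [A0|A0] := pselect (A 0%R).
    rewrite (_ : _ @^-1` A = setT) ?setIT ?probability_setT ?mule1//.
    by apply/seteqP; split.
  rewrite (_ : _ @^-1` A = set0) ?setI0 ?measure0 ?mule0//.
  by apply/seteqP; split.
have mB B : measurable B -> measurable (X N @^-1` B).
  exact: preimage_measurable.
pose W := mfun_of (measurable_fsum N).
pose V := mfun_of (mX N).
have pair F : measurable F -> indep_event F N.+1 X ->
    forall A B, measurable A -> measurable B ->
    P (F `&` (W @^-1` A `&` V @^-1` B)) = P F * P (W @^-1` A) * P (V @^-1` B).
  move=> mF iF C B mC mB'.
  have [iFB PFB] := indep_event_restrict mX mB' iF.
  rewrite (setIC (W @^-1` C)) setIA /W /V/=.
  rewrite (IH (F `&` X N @^-1` B))//; last 2 first.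
  - by apply: measurableI => //; exact: mB.
  - exact: indep_event_pred iT.
  by rewrite PFB muleAC.
pose S := (fun z : R * R => z.1 + f N z.2)%R @^-1` A.
have mS : measurable S.
  rewrite -[S]setTI; apply: (_ : measurable_fun setT _) => //.
  apply: measurable_funD => //; exact: measurableT_comp.
have SE : fsum N.+1 @^-1` A = (fun w => (W w, V w)) @^-1` S.
  by apply/seteqP; split=> w; rewrite /S /= /fsum big_ord_recr.
rewrite SE (indep_pair mE (pair E mE iE) mS).
by have := indep_pair measurableT (pair _ measurableT iT) mS;
  rewrite setTI probability_setT mul1e => ->.
Qed.

Lemma fsum_fubini N : indep_family N.+1 X ->
  forall h : R -> R, measurable_fun setT h -> (forall z, 0 <= h z)%R ->
  \int[P]_w (h (fsum N.+1 w))%:E =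
  \int[P]_w \int[P]_w' (h (fsum N w + f N (X N w'))%R)%:E.
Proof.
move=> iT h mh h0.
pose W := mfun_of (measurable_fsum N).
pose V := mfun_of (mX N).
have pair A B : measurable A -> measurable B ->
     P (W @^-1` A `&` V @^-1` B) = P (W @^-1` A) * P (V @^-1` B).
  move=> mA mB.
  have [] := indep_event_restrict mX mB iT.
  rewrite setTI => iFB _.
  rewrite setIC /W /V/= (indep_event_fsum _ _ iFB)//.
  - by rewrite muleC.
  - exact: preimage_measurable.
  - exact: indep_event_pred iT.
have := indep_pair_fubini pair (h := fun z => h (z.1 + f N z.2)%R).
rewrite /= => <- //.
- by apply: eq_integral => w _; rewrite /fsum big_ord_recr.
- apply: measurableT_comp => //; apply: measurable_funD => //.
  exact: measurableT_comp.
Qed.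
End sums.

Section rows.
Variables (X : nat -> nat -> T -> R) (f : nat -> R -> R) (m : nat).
Hypotheses (mX : forall i j, measurable_fun setT (X i j))
  (mf : forall j, measurable_fun setT (f j)).

(** The analogue of [indep_event] for an array, where whole rows are absorbed. *)
Definition indep_array (E : set T) (n : nat) :=
  forall B : nat -> nat -> set R, (forall i j, measurable (B i j)) ->
    P (E `&` \big[setI/setT]_(i < n) \big[setI/setT]_(j < m)
         (X i j @^-1` B i j)) =
    P E * \prod_(i < n) \prod_(j < m) P (X i j @^-1` B i j).

Let block n (B : nat -> nat -> set R) :=
  \big[setI/setT]_(i < n) \big[setI/setT]_(j < m) (X i j @^-1` B i j).

Let mblock n B : (forall i j, measurable (B i j)) -> measurable (block n B).
Proof.
move=> mB; apply: bigsetI_measurable => i _; apply: bigsetI_measurable => j _.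
exact: preimage_measurable.
Qed.

Lemma indep_array_restrict E n B : (forall i j, measurable (B i j)) ->
  indep_array E n.+1 ->
  indep_event (E `&` block n B) m (X n) /\
  P (E `&` block n B) =
    P E * \prod_(i < n) \prod_(j < m) P (X i j @^-1` B i j).
Proof.
move=> mB iE.
have key (C : nat -> set R) : (forall j, measurable (C j)) ->
    P (E `&` block n B `&` \big[setI/setT]_(j < m) (X n j @^-1` C j)) =
    P E * (\prod_(i < n) \prod_(j < m) P (X i j @^-1` B i j)) *
      \prod_(j < m) P (X n j @^-1` C j).
  move=> mC; pose D i := if i == n then C else B i.
  have mD i j : measurable (D i j) by rewrite /D; case: ifP.
  have DB (i : 'I_n) : D i = B i by rewrite /D ltn_eqF.
  have := iE _ mD; rewrite !big_ord_recr /= {2 4}/D eqxx.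
  under eq_bigr do rewrite DB.
  under [in X in _ = X -> _]eq_bigr do rewrite DB.
  by rewrite -/(block n B) setIA muleA.
have PE : P (E `&` block n B) =
    P E * \prod_(i < n) \prod_(j < m) P (X i j @^-1` B i j).
  have := key (fun=> setT) (fun=> measurableT).
  under eq_bigr do rewrite preimage_setT.
  under [X in _ = _ * X -> _]eq_bigr do rewrite preimage_setT probability_setT.
  by rewrite !big1_eq setIT mule1.
by split=> // C mC; rewrite key// PE.
Qed.

Lemma indep_family_row n : indep_array setT n.+1 -> indep_family m (X n).
Proof.
move=> /(indep_array_restrict (B := fun _ _ => setT) (fun _ _ => measurableT))[+ _].
by rewrite /block setTI big1// => i _; rewrite big1.
Qed.

Lemma indep_array_pred E n : indep_array E n.+1 -> indep_array E n.
Proof. by move=> iE B mB; have [] := indep_array_restrict mB iE. Qed.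

(** Rows are replaced by their sums one at a time; the events on the sums
    already treated are part of E. *)
Lemma indep_rows n E : measurable E -> indep_array setT n -> indep_array E n ->
  indep_event E n (fun i => fsum (X i) f m).
Proof.
elim: n E => [|n IH] E mE iT iE A mA; first by rewrite !big_ord0 setIT mule1.
have mY i B : measurable B -> measurable (fsum (X i) f m @^-1` B).
  by move=> mB; apply: preimage_measurable => //; exact: measurable_fsum.
have key B : (forall i j, measurable (B i j)) ->
    P (E `&` block n B `&` fsum (X n) f m @^-1` A n) =
    P (E `&` block n B) * P (fsum (X n) f m @^-1` A n).
  move=> mB; have [iEB _] := indep_array_restrict mB iE.
  apply: indep_event_fsum => //; first by apply: measurableI => //; exact: mblock.
  exact: indep_family_row.
have PE : P (E `&` fsum (X n) f m @^-1` A n) = P E * P (fsum (X n) f m @^-1` A n).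
  have := key (fun _ _ => setT) (fun _ _ => measurableT).
  rewrite (_ : block n _ = setT) ?setIT// /block big1// => i _.
  by rewrite big1// => j _; rewrite preimage_setT.
rewrite !big_ord_recr/= (setIC (\big[_/_]_(_ < _) _)) setIA IH//.
- by rewrite PE muleA muleAC.
- by apply: measurableI => //; exact: mY.
- exact: indep_array_pred.
- move=> B mB; rewrite -/(block n B) setIAC key// PE.
  have [_ ->] := indep_array_restrict mB iE.
  by rewrite muleAC.
Qed.
End rows.

Section laplace.
Variables (X : nat -> T -> R) (f : nat -> R -> R).
Hypotheses (mX : forall i, measurable_fun setT (X i))
  (mf : forall i, measurable_fun setT (f i)).

(** The Laplace transform of (Y + c)^2 for a centered normal Y of variance v. The
    shift c is what makes this property stable under independent sums: it takes the
    value of the other summands while one of them is integrated out. *)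
Definition gaussian_laplace (Y : T -> R) (v : R) :=
  forall t c : R, (0 < 1 + 2 * t * v)%R ->
  \int[P]_w (expR (- t * (Y w + c) ^+ 2))%:E =
  ((Num.sqrt (1 + 2 * t * v))^-1 * expR (- t * c ^+ 2 / (1 + 2 * t * v)))%:E.

(** Integrating over the last summand turns (t, c) into (t / a, c) with
    a = 1 + 2 t v_N, and the factors combine by
    a (1 + 2 (t / a) V) = 1 + 2 t (V + v_N). *)
Lemma gaussian_laplace_fsum (v : nat -> R) N : indep_family N X ->
  (forall i, 0 <= v i)%R -> (forall i, gaussian_laplace (f i \o X i) (v i)) ->
  gaussian_laplace (fsum X f N) (\sum_(i < N) v i)%R.
Proof.
move=> iX v0 gl; elim: N iX => [|N IH] iX t c.
  rewrite big_ord0 mulr0 addr0 sqrtr1 invr1 mul1r mulr1 => _.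
  under eq_integral do rewrite /fsum big_ord0 add0r.
  by rewrite integral_cst//= probability_setT mule1.
rewrite big_ord_recr/=; set V := (\sum_(i < N) v i)%R => t0.
have V0 : (0 <= V)%R by exact: sumr_ge0.
have a0 : (0 < 1 + 2 * t * v N)%R.
  have [tge|tlt] := lerP 0%R t; first by rewrite ltr_pwDl// !mulr_ge0.
  have := v0 N; nra.
rewrite (fsum_fubini mX mf iX (h := fun z => expR (- t * (z + c) ^+ 2))) //; last first.
  apply: (measurableT_comp (@measurable_expR R)); apply: measurable_funM => //.
  by apply: measurable_funX; exact: measurable_funD.
set a := (1 + 2 * t * v N)%R in a0 *.
have b0 : (0 < 1 + 2 * (t / a) * V)%R.
  rewrite (_ : 1 + _ = (1 + 2 * t * (V + v N)) / a)%R ?divr_gt0//.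
  by rewrite /a; field; rewrite -/a gt_eqF.
transitivity (\int[P]_w
    ((Num.sqrt a)^-1 * expR (- (t / a) * (fsum X f N w + c) ^+ 2))%:E).
  apply: eq_integral => w _.
  have := gl N t (fsum X f N w + c)%R a0.
  rewrite -/a (_ : - t * (fsum X f N w + c) ^+ 2 / a =
   - (t / a) * (fsum X f N w + c) ^+ 2)%R; last by rewrite mulrAC mulNr.
  by move=> <-; apply: eq_integral => w' _ /=; congr (expR (_ * _ ^+ 2))%:E; ring.
under eq_integral do rewrite EFinM.
rewrite ge0_integralZl//=; last first.
  apply/measurable_EFinP; apply: (measurableT_comp (@measurable_expR R)).
  apply: measurable_funM => //; apply: measurable_funX.
  by apply: measurable_funD => //; exact: measurable_fsum.
rewrite IH//; last exact: indep_event_pred iX.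
rewrite -/V -EFinM; congr _%:E.
rewrite [LHS]mulrA -invfM -sqrtrM ?(ltW a0)//.
have -> : (a * (1 + 2 * (t / a) * V) = 1 + 2 * t * (V + v N))%R.
  by rewrite /a; field; rewrite -/a gt_eqF.
congr (_ * expR _)%R; rewrite /a; field.
rewrite -/a gt_eqF//= gt_eqF//.
Qed.

Lemma laplace_fsum (t a : R) N : indep_family N X ->
  (forall i, \int[P]_w (expR (- t * f i (X i w)))%:E = a%:E) ->
  \int[P]_w (expR (- t * fsum X f N w))%:E = (a ^+ N)%:E.
Proof.
move=> iX fa; elim: N iX => [|N IH] iX.
  under eq_integral do rewrite /fsum big_ord0 mulr0 expR0.
  by rewrite integral_cst//= probability_setT mule1.
rewrite (fsum_fubini mX mf iX (h := fun z => expR (- t * z))) //; last first.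
  by apply: (measurableT_comp (@measurable_expR R)); apply: measurable_funM.
have a0 : (0 <= a)%R.
  by rewrite -lee_fin -(fa N); apply: integral_ge0 => w _; rewrite lee_fin expR_ge0.
transitivity (\int[P]_w (a%:E * (expR (- t * fsum X f N w))%:E)).
  apply: eq_integral => w _; rewrite -(fa N).
  under eq_integral do rewrite mulrDr expRD EFinM.
  rewrite ge0_integralZl//=.
  - by rewrite muleC.
  - apply/measurable_EFinP; apply: (measurableT_comp (@measurable_expR R)).
    by apply: measurable_funM => //; exact: measurableT_comp.
rewrite ge0_integralZl//=.
- by rewrite IH ?exprS ?EFinM//; exact: indep_event_pred iX.
- apply/measurable_EFinP; apply: (measurableT_comp (@measurable_expR R)).
  by apply: measurable_funM => //; exact: measurable_fsum.
Qed.
End laplace.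

(** Chernoff bound; t of either sign is allowed, so that both tails are covered. *)
Lemma laplace_tail (Y : T -> R) (t s b : R) : measurable_fun setT Y ->
  \int[P]_w (expR (- t * Y w))%:E = b%:E ->
  P [set w | (t * Y w <= s)%R] <= (expR s * b)%:E.
Proof.
move=> mY Eb; set A := [set w | _].
have mtY : measurable_fun setT (fun w => t * Y w)%R by exact: measurable_funM.
have mA : measurable A.
  rewrite (_ : A = (fun w => t * Y w)%R @^-1` `]-oo, s]%classic).
    exact: preimage_measurable.
  by apply/seteqP; split => w; rewrite /A /= in_itv.
rewrite -[leLHS]mul1e -{1}(mul1e (P A)) -[X in 1 * (1 * P X)]setIT.
rewrite -integral_indic// mul1e mul1e EFinM -Eb -ge0_integralZl//=; last first.
  apply/measurable_EFinP; apply: (measurableT_comp (@measurable_expR R)).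
  by apply: measurable_funM.
apply: ge0_le_integral => //=.
- by apply/measurable_EFinP; exact: measurable_indic.
- apply/measurable_EFinP; apply: measurable_funM => //.
  by apply: (measurableT_comp (@measurable_expR R)); apply: measurable_funM.
- move=> w _; rewrite -EFinM lee_fin -expRD indicE.
  have [|_] := boolP (w \in A); last exact: expR_ge0.
  rewrite inE /A/= => tYs; rewrite -expR0 ler_expR; lra.
Qed.

End independence.

(** * Norms of Gaussian images of a fixed vector *)

Section gaussian_laplace.
Context d (T : measurableType d) (R : realType) (P : probability T R).
Local Open Scope ereal_scope.

Definition gmx {n m : nat} (g : 'I_n * 'I_m -> {RV P >-> R}) (w : T) :
  'M[R]_(n, m) := \matrix_(i, j) g (i, j) w.

Lemma standard_normal_laplace (X : {RV P >-> R}) (k : R) :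
  standard_normal X ->
  gaussian_laplace P ((fun x => k * x)%R \o X) (k ^+ 2).
Proof.
move=> sX t c tk0.
rewrite -normal_laplace//.
transitivity (\int[distribution P X]_x (expR (- t * (k * x + c) ^+ 2))%:E); last first.
  have mid : @measurable_fun _ _ (measurableTypeR R) R setT id.
    by move=> _ A mA; rewrite setTI.
  have mh : measurable_fun setT (fun x : R => (expR (- t * (k * x + c) ^+ 2))%:E).
    apply/measurable_EFinP; apply: (measurableT_comp (@measurable_expR R)).
    apply: measurable_funM => //; apply: measurable_funX.
    by apply: measurable_funD => //; exact: measurable_funM.
  have := ge0_integral_pushforward mid (normal_prob 0 1) measurableT mh.
  rewrite preimage_setT => <-; last by move=> y _; rewrite lee_fin expR_ge0.
  by apply: eq_measure_integral => A mA _; exact: sX.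
rewrite ge0_integral_distribution//=.
apply/measurable_EFinP; apply: (measurableT_comp (@measurable_expR R)).
apply: measurable_funM => //; apply: measurable_funX.
by apply: measurable_funD => //; exact: measurable_funM.
Qed.

(** The array is indexed by all natural numbers; indices out of range repeat the
    entry of index 0, which the product rule for the first n.+1 rows and m.+1
    columns does not see. *)
Lemma indep_array_gaussian n m (g : 'I_n.+1 * 'I_m.+1 -> {RV P >-> R}) :
  mutually_independent g ->
  indep_array P (fun i j => g (inord i, inord j)) m.+1 setT n.+1.
Proof.
move=> ig B mB.
have := ig [set: _]%SET (fun ij => B ij.1 ij.2) (fun ij => mB _ _).
rewrite probability_setT mul1e setTI.
have -> : \bigcap_(i in [set` [set: 'I_n.+1 * 'I_m.+1]%SET]) (g i @^-1` B i.1 i.2) =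
   \big[setI/setT]_(i < n.+1) \big[setI/setT]_(j < m.+1)
     (g (inord i, inord j) @^-1` B i j).
  under [RHS]eq_bigr do
    rewrite -(bigcap_mkord _ (fun j => g (inord _, inord j) @^-1` B _ j)).
  rewrite -(bigcap_mkord _ (fun i =>
    \bigcap_(j in `I_m.+1) (g (inord i, inord j) @^-1` B i j))).
  apply/seteqP; split => w /=.
    move=> H i /= im j /= jm; have := H (inord i, inord j).
    by rewrite /= !inordK//; apply; rewrite inE.
  by move=> H [i j] _; have := H i (ltn_ord i) j (ltn_ord j); rewrite /= !inord_val.
move=> ->.
transitivity (\prod_(i < n.+1) \prod_(j < m.+1) P (g (i, j) @^-1` B i j)).
  by rewrite pair_bigA/=; apply: eq_big => [|[]//] x; rewrite inE.
by apply: eq_bigr => i _; apply: eq_bigr => j _; rewrite !inord_val.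
Qed.

Lemma measurable_sqnorm_mul n m (g : 'I_n * 'I_m -> {RV P >-> R}) (k : 'cV[R]_m) :
  measurable_fun setT (fun w => sqnorm (gmx g w *m k)).
Proof.
apply: measurable_sum => i; apply: measurable_funX.
under eq_fun do rewrite mxE.
apply: measurable_sum => j; apply: measurable_funM => //.
by apply: (eq_measurable_fun (g (i, j))) => // w _; rewrite mxE.
Qed.

Lemma sqnorm_gaussian_laplace n m (g : 'I_n.+1 * 'I_m.+1 -> {RV P >-> R})
    (k : 'cV[R]_m.+1) (s : R) :
  gaussian_matrix g -> (0 < sqnorm k)%R -> (0 < 1 + 2 * s)%R ->
  \int[P]_w (expR (- (s / sqnorm k) * sqnorm (gmx g w *m k)))%:E =
  ((Num.sqrt (1 + 2 * s))^-1 ^+ n.+1)%:E.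
Proof.
move=> [ig sg] k0 s0.
pose X i j := g (inord i : 'I_n.+1, inord j : 'I_m.+1) : T -> R.
pose f j (x : R) := (k (inord j) 0 * x)%R.
have mX i j : measurable_fun setT (X i j) by [].
have mf j : measurable_fun setT (f j) by exact: measurable_funM.
have iX : indep_array P X m.+1 setT n.+1 by exact: indep_array_gaussian.
have iY : indep_family P n.+1 (fun i => fsum (X i) f m.+1) by exact: indep_rows.
have iXr i : indep_family P m.+1 (X i).
  have -> : X i = X (inord i : 'I_n.+1) by rewrite /X inord_val.
  suff H : indep_array P X m.+1 setT (inord i : 'I_n.+1).+1.
    exact: (indep_family_row H).
  case: (inord i) => {}i /=; rewrite ltnS => ile.
  elim: (n) ile iX => [|p IH]; first by rewrite leqn0 => /eqP ->.
  rewrite leq_eqVlt => /predU1P[-> //|/IH] H iX'; apply: H.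
  exact: indep_array_pred iX'.
rewrite -(@laplace_fsum _ _ _ P (fun i => fsum (X i) f m.+1) (fun _ y => y ^+ 2)%R _ _
  (s / sqnorm k)%R)//.
- apply: eq_integral => w _; congr (expR (_ * _))%:E.
  apply: eq_bigr => i _; congr (_ ^+ 2)%R; rewrite mxE.
  by apply: eq_bigr => j _; rewrite mxE mulrC /f /X !inord_val.
- by move=> i; exact: measurable_fsum.
- move=> i.
  have gl : gaussian_laplace P (fsum (X i) f m.+1)
      (\sum_(j < m.+1) (k (inord j) 0) ^+ 2)%R.
    apply: (@gaussian_laplace_fsum _ _ _ P (X i) f _ _
      (fun j => k (inord j) 0 ^+ 2)%R) => //.
      by move=> j; exact: sqr_ge0.
    by move=> j; exact: standard_normal_laplace.
  have kE : (\sum_(j < m.+1) (k (inord j) 0) ^+ 2)%R = sqnorm k.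
    by apply: eq_bigr => j _; rewrite inord_val.
  have e : (2 * (s / sqnorm k) * sqnorm k = 2 * s)%R.
    by field; rewrite gt_eqF.
  have := gl (s / sqnorm k)%R 0%R; rewrite kE e => /(_ s0).
  rewrite expr0n/= mulr0 mul0r expR0 mulr1 => <-.
  by apply: eq_integral => w _; rewrite addr0.
Qed.

End gaussian_laplace.

Section gaussian_tails.
Context d (T : measurableType d) (R : realType) (P : probability T R).

Lemma ln2_gt0 : (0 < ln 2 :> R)%R.
Proof. by rewrite ln_gt0// ltr1n. Qed.

Let expRln2 : expR (ln 2) = 2 :> R.
Proof. by rewrite lnK// posrE. Qed.

(** At t = 3/2 the Laplace transform is 2 ^ (- n); the threshold is chosen so that
    the exponential factor is 2 ^ (n / 2). *)
Lemma sqnorm_gaussian_lower n m (g : 'I_n.+1 * 'I_m.+1 -> {RV P >-> R})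
    (k : 'cV[R]_m.+1) :
  gaussian_matrix g -> (0 < sqnorm k)%R ->
  (P [set w | (sqnorm (gmx g w *m k) <= ln 2 / 3 * n.+1%:R * sqnorm k)%R] <=
  (expR (- (ln 2 / 2 * n.+1%:R)))%:E)%E.
Proof.
move=> gg k0.
have H := sqnorm_gaussian_laplace (s := (3 / 2)%R) gg k0.
have -> : expR (- (ln 2 / 2 * n.+1%:R)) =
    expR (ln 2 / 2 * n.+1%:R) * (Num.sqrt (1 + 2 * (3 / 2) : R))^-1 ^+ n.+1.
  rewrite (_ : 1 + 2 * (3 / 2) = 2 ^+ 2)%R; last by field.
  rewrite sqrtr_sqr ger0_norm//.
  transitivity (expR (ln 2 / 2 * n.+1%:R) * expR (- ln 2) ^+ n.+1 : R).
    by rewrite -expRM_natl -expRD; congr expR; field.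
  by rewrite expRN expRln2.
rewrite (_ : [set w | _] = [set w | (3 / 2 / sqnorm k * sqnorm (gmx g w *m k) <=
   ln 2 / 2 * n.+1%:R)%R]).
  have H0 : 0 < 1 + 2 * (3 / 2) :> R by lra.
  exact: (laplace_tail _ (measurable_sqnorm_mul g k) (H H0)).
apply/seteqP; split => w /=;
  by rewrite [_ / sqnorm k * _]mulrAC ler_pdivrMr// => h; lra.
Qed.

(** At t = - 3/8 the Laplace transform is 2 ^ n; the threshold is chosen so that the
    exponential factor is 2 ^ (- 3 n / 2). *)
Lemma sqnorm_gaussian_upper n m (g : 'I_n.+1 * 'I_m.+1 -> {RV P >-> R})
    (k : 'cV[R]_m.+1) :
  gaussian_matrix g -> (0 < sqnorm k)%R ->
  (P [set w | (4 * ln 2 * n.+1%:R * sqnorm k <= sqnorm (gmx g w *m k))%R] <=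
  (expR (- (ln 2 / 2 * n.+1%:R)))%:E)%E.
Proof.
move=> gg k0.
have H := sqnorm_gaussian_laplace (s := (- 3 / 8)%R) gg k0.
have -> : expR (- (ln 2 / 2 * n.+1%:R)) =
    expR (- (3 / 2 * ln 2 * n.+1%:R)) *
    (Num.sqrt (1 + 2 * (- 3 / 8) : R))^-1 ^+ n.+1.
  rewrite (_ : 1 + 2 * (- 3 / 8) = (2^-1) ^+ 2)%R; last by field.
  rewrite sqrtr_sqr ger0_norm// invrK.
  transitivity (expR (- (3 / 2 * ln 2 * n.+1%:R)) * expR (ln 2) ^+ n.+1 : R).
    by rewrite -expRM_natl -expRD; congr expR; field.
  by rewrite expRln2.
rewrite (_ : [set w | _] = [set w | (- 3 / 8 / sqnorm k * sqnorm (gmx g w *m k) <=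
   - (3 / 2 * ln 2 * n.+1%:R))%R]).
  have H0 : 0 < 1 + 2 * (- 3 / 8) :> R by lra.
  exact: (laplace_tail _ (measurable_sqnorm_mul g k) (H H0)).
apply/seteqP; split => w /=;
  by rewrite [_ / sqnorm k * _]mulrAC ler_pdivrMr// => h; lra.
Qed.
End gaussian_tails.

(** * Counting integer vectors *)

Section counting.
Context {R : realType}.

(** Integers of absolute value at most N, each represented once: Some (b, l) stands
    for (-1) ^ b * (l + 1). A redundant representation of 0 would spoil the count
    below, where most coordinates vanish. *)
Definition signed_int (N : nat) (o : option (bool * 'I_N)) : int :=
  if o is Some (b, l) then (-1) ^+ b * l.+1%:Z else 0.

Definition weight (N : nat) (o : option (bool * 'I_N)) : nat :=
  if o is Some (_, l) then l.+1 else 0%N.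

Definition int_net (m N : nat) : {set {ffun 'I_m -> option (bool * 'I_N)}} :=
  [set f : {ffun 'I_m -> option (bool * 'I_N)} | (\sum_i weight (f i) <= N)%N]%SET.

Definition net_point m N (f : {ffun 'I_m -> option (bool * 'I_N)}) : 'cV[R]_m :=
  \col_i (signed_int (f i))%:~R.

(** The net is defined by the l1 norm, which on integer vectors is at most the
    squared Euclidean norm. *)
Lemma int_net_surj m N (k : 'cV[int]_m) :
  sqnorm (map_mx intr k : 'cV[R]_m) <= N%:R ->
  exists2 f, f \in int_net m N & net_point f = map_mx intr k.
Proof.
move=> kN.
have sE : sqnorm (map_mx intr k : 'cV[R]_m) = (\sum_i `|k i 0%R| ^ 2)%N%:R.
  rewrite natr_sum; apply: eq_bigr => i _.
  by rewrite mxE -[(k i 0)%:~R ^+ 2]real_normK ?num_real// -intr_norm natrX.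
rewrite sE ler_nat in kN.
have kiN i : (`|k i 0%R| <= N)%N.
  apply: leq_trans kN; rewrite (bigD1 i)//= (leq_trans _ (leq_addr _ _))//.
  by rewrite -mulnn; case: (`|k i 0%R|%N) => // l; rewrite leq_pmull.
have ex i : exists o : option (bool * 'I_N),
    signed_int o = k i 0 /\ weight o = `|k i 0%R|%N.
  have := kiN i; case: (k i 0) => [[|l]|l] lN.
  - by exists None.
  - by exists (Some (false, Ordinal lN)); rewrite /= expr0 mul1r.
  - by exists (Some (true, Ordinal lN)); rewrite /= expr1 mulN1r.
have [f fP] := choice ex.
exists [ffun i => f i].
  rewrite inE (leq_trans _ kN)//; apply: leq_sum => i _; rewrite ffunE.
  have [_ ->] := fP i.
  by rewrite -mulnn; case: (`|k i 0%R|%N) => // l; rewrite leq_pmull.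
by apply/colP => i; rewrite !mxE ffunE; have [->] := fP i.
Qed.

Lemma weight_sum_le N (th : R) : 0 < th -> th <= 1 / 2 ->
  \sum_(o : option (bool * 'I_N)) th ^+ weight o <= 1 + 4 * th.
Proof.
move=> th0 th1; rewrite (bigD1 None)//= expr0 lerD2l.
rewrite (reindex_omap Some id)/=; last by case.
rewrite (eq_bigl predT); last by move=> x; rewrite eqxx.
rewrite (eq_bigr (fun x : bool * 'I_N => th * th ^+ x.2)); last first.
  by move=> [b l] _; rewrite exprS.
rewrite -(pair_bigA _ (fun (b : bool) (l : 'I_N) => th * th ^+ l))/=.
rewrite big_bool/= -mulr_sumr.
have geo : \sum_(l < N) th ^+ l <= 2.
  have := subrX1 th N; have := exprn_ge0 N (ltW th0).
  set S := \sum_(_ < _) _; nra.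
nra.
Qed.

(** A vector of l1 norm w is counted with the weight th ^ (w - N) >= 1. The sum of
    these weights over all vectors factorizes over the coordinates. *)
Lemma card_int_net m N (th : R) : 0 < th -> th <= 1 / 2 ->
  #|int_net m N|%:R <= expR (N%:R * ln th^-1 + 4 * th * m%:R).
Proof.
move=> th0 th1.
have -> : expR (N%:R * ln th^-1 + 4 * th * m%:R) = (th ^- N) * expR (4 * th) ^+ m.
  by rewrite expRD expRM_natl lnK ?posrE ?invr_gt0// exprVn -expRM_natr.
rewrite mulrC ler_pdivlMr ?exprn_gt0//.
apply: (@le_trans _ _ (\sum_(f in int_net m N) th ^+ (\sum_i weight (f i)))).
  rewrite -sum1_card natr_sum mulr_suml; apply: ler_sum => f; rewrite inE => fN.
  by rewrite mul1r ler_wiXn2l// ?(ltW th0)//; lra.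
apply: (@le_trans _ _ (\sum_(f : {ffun 'I_m -> option (bool * 'I_N)})
    \prod_i th ^+ weight (f i))).
  rewrite [leRHS](bigID (fun f => f \in int_net m N))/= ler_wpDr//.
    by apply: sumr_ge0 => f _; apply: prodr_ge0 => i _; rewrite exprn_ge0// ltW.
  by apply: ler_sum => f _; rewrite prodrXr.
rewrite -(bigA_distr_bigA (fun _ o => th ^+ weight o)).
rewrite prodr_const card_ord lerXn2r ?nnegrE ?expR_ge0//.
  by apply: sumr_ge0 => o _; rewrite exprn_ge0// ltW.
by rewrite (le_trans (weight_sum_le _ th0 th1))// expR_ge1Dx.
Qed.
End counting.

(** * Sections of the ellipsoid by the kernel of a fixed matrix *)

Section kernel_sections.
Context {R : realType}.

(** The points of {0, 1}^m of coordinate sum at most N are the extreme points of the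
    part of the cube [0, 1]^m of coordinate sum at most N. By induction on the
    number of fractional coordinates: with two of them, their sum can be kept
    while moving in either direction until one of the two becomes an integer;
    a single one can be moved to 0 and to 1, because N is an integer. *)
Lemma le_box_extreme m (F : 'cV[R]_m -> R) (N : nat) (M : R) :
  (forall x y (t : R), 0 <= t -> t <= 1 ->
     F (t *: x + (1 - t) *: y) <= Num.max (F x) (F y)) ->
  (forall v : 'cV[R]_m, (forall i, v i 0 = 0 \/ v i 0 = 1) ->
     \sum_i v i 0 <= N%:R -> F v <= M) ->
  forall a : 'cV[R]_m, (forall i, 0 <= a i 0 <= 1) ->
    \sum_i a i 0 <= N%:R -> F a <= M.
Proof.
move=> cF FM.
pose frac (a : 'cV[R]_m) := [set i | 0 < a i 0 < 1]%SET.
have aux (a d : 'cV[R]_m) (al be : R) : 0 < al -> 0 < be ->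
    F (a - al *: d) <= M -> F (a + be *: d) <= M -> F a <= M.
  move=> al0 be0 F1 F2.
  have ab0 : 0 < al + be by exact: addr_gt0.
  have := cF (a + be *: d) (a - al *: d) (al / (al + be)).
  rewrite (_ : _ *: _ + _ *: _ = a); last first.
    apply/colP => i; rewrite !mxE; field; exact: lt0r_neq0.
  have t1 : al / (al + be) <= 1 by rewrite ler_pdivrMr// mul1r lerDl ltW.
  move=> /(_ (divr_ge0 (ltW al0) (ltW ab0)) t1) /le_trans; apply.
  by rewrite ge_max F2.
move=> a; have [q] := ubnP #|frac a|; elim: q a => // q IH a qa a01 sa.
have nfracP l : l \notin frac a -> a l 0 = 0 \/ a l 0 = 1.
  rewrite inE negb_and -!leNgt => /orP[] h; have /andP[h1 h2] := a01 l.
    by left; apply/eqP; rewrite eq_le h h1.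
  by right; apply/eqP; rewrite eq_le h h2.
have [f0|[i ifrac]] := set_0Vmem (frac a).
  by apply: FM => // l; apply: nfracP; rewrite f0 inE.
have := ifrac; rewrite inE => /andP[ai0 ai1].
have step (b : 'cV[R]_m) : (forall l, l \notin frac a -> b l 0 = a l 0) ->
    (forall l, 0 <= b l 0 <= 1) -> \sum_l b l 0 <= N%:R ->
    (exists2 l, l \in frac a & l \notin frac b) -> F b <= M.
  move=> ba b01 sb [l la lb]; apply: IH => //.
  rewrite -ltnS (leq_trans _ qa)// ltnS proper_card//.
  apply/fintype.properP; split; last by exists l.
  apply/fintype.subsetP => j; apply: contraLR => jn; move: (jn).
  by rewrite !inE ba.
have [[j jfrac ji]|noj] := pselect (exists2 j, j \in frac a & j != i).
  pose d : 'cV[R]_m := delta_mx i 0 - delta_mx j 0.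
  have dE l : d l 0 = (l == i)%:R - (l == j)%:R.
    by rewrite !mxE !eqxx !andbT.
  have di : d i 0 = 1 by rewrite dE eqxx eq_sym (negbTE ji) subr0.
  have dj : d j 0 = -1 by rewrite dE eqxx (negbTE ji) sub0r.
  have dl l : l != i -> l != j -> d l 0 = 0.
    by rewrite dE => /negbTE-> /negbTE->; rewrite subrr.
  have := jfrac; rewrite inE => /andP[aj0 aj1].
  have move_d s : 0 <= a i 0 + s <= 1 -> 0 <= a j 0 - s <= 1 ->
      [|| a i 0 + s <= 0, 1 <= a i 0 + s, a j 0 - s <= 0 | 1 <= a j 0 - s] ->
      F (a + s *: d) <= M.
    move=> si sj ends; apply: step.
    - move=> l la; rewrite mxE [(s *: d) l 0]mxE dl ?mulr0 ?addr0//.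
        by apply: contraNneq la => ->.
      by apply: contraNneq la => ->.
    - move=> l; rewrite mxE [(s *: d) l 0]mxE.
      have [->|li] := eqVneq l i; first by rewrite di mulr1.
      have [->|lj] := eqVneq l j; first by rewrite dj mulrN1.
      by rewrite dl// mulr0 addr0.
    - rewrite (_ : \sum_l _ = \sum_l a l 0)//.
      under eq_bigr do rewrite mxE [(s *: d) _ 0]mxE dE.
      rewrite big_split/= -mulr_sumr sumrB.
      have delta1 k : \sum_(l < m) (l == k)%:R = 1 :> R.
        by rewrite (bigD1 k)//= eqxx big1 ?addr0// => l /negbTE->.
      by rewrite !delta1 subrr mulr0 addr0.
    - have bi : (a + s *: d) i 0 = a i 0 + s.
        by rewrite mxE [(s *: d) i 0]mxE di mulr1.
      have bj : (a + s *: d) j 0 = a j 0 - s.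
        by rewrite mxE [(s *: d) j 0]mxE dj mulrN1.
      move: ends; rewrite orbA.
      move=> /orP[] /orP[] h; [exists i|exists i|exists j|exists j] => //.
      + by rewrite inE bi ltNge h.
      + by rewrite inE bi [_ < 1]ltNge h andbF.
      + by rewrite inE bj ltNge h.
      + by rewrite inE bj [_ < 1]ltNge h andbF.
  pose al := Num.min (a i 0) (1 - a j 0).
  pose be := Num.min (1 - a i 0) (a j 0).
  apply: (aux a d al be).
  - by rewrite lt_min ai0 subr_gt0.
  - by rewrite lt_min subr_gt0 ai1.
  - rewrite -scaleNr; apply: move_d; rewrite /al minElt; case: ifPn;
      rewrite -?leNgt => h; try by apply/andP; split; lra.
    + by apply/or4P; apply: Or41; lra.
    + by apply/or4P; apply: Or44; lra.
  - apply: move_d; rewrite /be minElt; case: ifPn;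
      rewrite -?leNgt => h; try by apply/andP; split; lra.
    + by apply/or4P; apply: Or42; lra.
    + by apply/or4P; apply: Or43; lra.
have al0 l : l != i -> a l 0 = 0 \/ a l 0 = 1.
  by move=> li; apply: nfracP; apply/negP => lf; apply: noj; exists l.
pose K := (\sum_(l < m | l != i) (a l 0 == 1%R)%R : nat)%N.
have KE : \sum_(l < m | l != i) a l 0 = K%:R.
  rewrite natr_sum; apply: eq_bigr => l li.
  by have [->|->] := al0 l li; rewrite ?eqxx// eq_sym oner_eq0.
have KN : (K < N)%N.
  rewrite -(ltr_nat R) (lt_le_trans _ sa)// (bigD1 i)//= KE.
  by rewrite ltrDr.
pose d : 'cV[R]_m := delta_mx i 0.
have dE (s : R) l : (a + s *: d) l 0 = if l == i then a i 0 + s else a l 0.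
  rewrite !mxE eqxx andbT; case: eqVneq => [->|_]; first by rewrite mulr1.
  by rewrite mulr0 addr0.
have dsum (s : R) : \sum_l (a + s *: d) l 0 = a i 0 + s + K%:R.
  rewrite (bigD1 i)//= dE eqxx -KE; congr (_ + _).
  by apply: eq_bigr => l li; rewrite dE (negbTE li).
apply: (aux a d (a i 0) (1 - a i 0)) => //; first by rewrite subr_gt0.
- rewrite -scaleNr; apply: FM; last by rewrite dsum subrr add0r ler_nat ltnW.
  by move=> l; rewrite dE subrr; case: eqVneq => [_|/al0//]; left.
- apply: FM; last by rewrite dsum [a i 0 + _]addrC subrK addrC natr1 ler_nat.
  move=> l; rewrite dE; case: eqVneq => [_|/al0//]; right.
  by rewrite addrC subrK.
Qed.

(** Rounding u / h towards zero gives an integer z.1.1, not larger in absolute value,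
    and a remainder of the same sign as u, of absolute value z.2. *)
Lemma truncate_toward0 (u h : R) : 0 < h ->
  exists z : int * bool * R,
    [/\ u = h * (z.1.1%:~R + (-1) ^+ z.1.2 * z.2), 0 <= z.2 <= 1,
        h * z.2 <= `|u| & z.1.1%:~R ^+ 2 <= (u / h) ^+ 2].
Proof.
move=> h0; set b := u < 0; set q := `|u| / h.
have q0 : 0 <= q by rewrite divr_ge0// ltW.
have /andP[tq qt] := truncn_itv q0; set t := Num.truncn q in tq qt.
have qh : h * q = `|u| by rewrite /q mulrCA mulfV ?mulr1// gt_eqF.
have uE : u = (-1) ^+ b * `|u|.
  rewrite /b; case: ltrP => u0; last by rewrite (ger0_norm u0) mul1r.
  by rewrite (ltr0_norm u0) expr1 mulN1r opprK.
exists ((-1) ^+ b * t%:Z, b, q - t%:R) => /=.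
have kE : ((-1) ^+ b * t%:Z)%:~R = (-1) ^+ b * t%:R :> R.
  by rewrite intrM rmorphXn/= rmorphN1.
split.
- by rewrite kE -mulrDr addrC subrK mulrCA qh.
- by rewrite subr_ge0 tq lerBlDr -natr1 addrC in qt *; rewrite ltW.
- by rewrite -qh ler_pM2l// gerBl ler0n.
- rewrite kE exprMn sqrr_sign mul1r.
  have -> : (u / h) ^+ 2 = q ^+ 2.
    by rewrite /q !exprMn real_normK// num_real.
  by rewrite lerXn2r ?nnegrE.
Qed.

(** The factor 12 is the ratio of the thresholds in [sqnorm_gaussian_upper] and
    [sqnorm_gaussian_lower]. *)
Definition int_near_isometry n m (G : 'M[R]_(n, m)) (al N : R) :=
  forall k : 'cV[int]_m, let x := map_mx intr k : 'cV[R]_m in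
  x != 0 -> sqnorm x <= N ->
  al * sqnorm x < sqnorm (G *m x) /\ sqnorm (G *m x) < 12 * al * sqnorm x.

(** With y = h (x + sg a), where sg restores the signs of the coordinates of y, the
    integer vector x and the remainder sg a have opposite images under G; but the
    image of x is long and that of sg a, a convex combination of short integer
    vectors, is short. The constant 49 is large enough for 3/4 (49 - 8) > 2 * 12. *)
Lemma kernel_section_gap n m (s : nat) (G : 'M[R]_(n, m)) (al h p : R)
    (y : 'cV[R]_m) :
  0 < al -> 0 < h -> 0 < p -> p <= 1 -> (0 < s)%N ->
  int_near_isometry G al (49 * s%:R) ->
  \sum_(i < m | (s <= i)%N) `|y i 0| `^ p <= s%:R * h `^ p ->
  G *m y = 0 -> sqnorm y != 49 * s%:R * h ^+ 2.
Proof.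
move=> al0 h0 p0 p1 s0 good tail Gy; apply/eqP => yE.
have s0R : 0 < s%:R :> R by rewrite ltr0n.
have [z zP] := choice (fun i => truncate_toward0 (y i 0) h0).
pose k : 'cV[int]_m := \col_i (z i).1.1.
pose a : 'cV[R]_m := \col_i (z i).2.
pose sg := fun v : 'cV[R]_m => \col_i ((-1) ^+ (z i).1.2 * v i 0) : 'cV[R]_m.
pose x : 'cV[R]_m := map_mx intr k.
have a01 i : 0 <= a i 0 <= 1 by rewrite mxE; have [] := zP i.
have sg_lin t u v : sg (t *: u + (1 - t) *: v) = t *: sg u + (1 - t) *: sg v.
  by apply/colP => i; rewrite !mxE; ring.
have sg_norm v : sqnorm (sg v) = sqnorm v.
  by apply: eq_bigr => i _; rewrite mxE exprMn sqrr_sign mul1r.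
have yxa : y = h *: (x + sg a).
  by apply/colP => i; rewrite !mxE; have [-> ] := zP i.
have suma : \sum_i a i 0 <= (2 * s)%:R.
  rewrite (bigID (fun i : 'I_m => (s <= i)%N))/= mul2n -addnn natrD; apply: lerD.
    have : \sum_(i < m | (s <= i)%N) `|y i 0| `^ p / h `^ p <= s%:R.
      by rewrite -mulr_suml ler_pdivrMr// powR_gt0.
    apply: le_trans; apply: ler_sum => i _.
    have /andP[ai0 ai1] := a01 i.
    have hy : a i 0 <= `|y i 0| / h.
      by rewrite ler_pdivlMr// mulrC mxE; have [] := zP i.
    have -> : `|y i 0| `^ p / h `^ p = (`|y i 0| / h) `^ p.
      rewrite powRM ?invr_ge0 ?(ltW h0)//; congr (_ * _).
      by rewrite -[in RHS]powR_inv1 ?(ltW h0)// -powRrM mulN1r powRN.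
    apply: (@le_trans _ _ (a i 0 `^ p)); last first.
      by apply: ge0_ler_powR; rewrite ?nnegrE ?(ltW p0)// divr_ge0// ltW.
    have [->|an0] := eqVneq (a i 0) 0; first by rewrite powR_ge0.
    by apply: ger1_powR; rewrite // lt0r an0 ai0.
  apply: (@le_trans _ _ (\sum_(i < m | ~~ (s <= i)%N) 1)).
    by apply: ler_sum => i _; have /andP[] := a01 i.
  (* at most s indices are smaller than s *)
  rewrite sumr_const ler_nat cardE -(size_map val) -[leqRHS](size_iota 0).
  apply: uniq_leq_size; first by rewrite (map_inj_uniq val_inj) enum_uniq.
  move=> _ /mapP[i + ->]; rewrite mem_enum mem_iota add0n /=.
  by rewrite unfold_in /= -ltnNge.
(* by convexity it suffices to bound the images of the 0-1 vectors v *)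
have Fa : sqnorm (G *m sg a) <= 24 * al * s%:R.
  apply: (@le_box_extreme m (fun v => sqnorm (G *m sg v)) (2 * s)%N) => //.
    by move=> u v t t0 t1; rewrite sg_lin; exact: quasiconvex_sqnorm.
  move=> v v01 sv.
  have [->|sv0] := eqVneq (sg v) 0.
    rewrite mulmx0 /sqnorm big1; last by move=> i _; rewrite mxE expr0n.
    by rewrite !mulr_ge0// ltW.
  pose kv : 'cV[int]_m := \col_i ((-1) ^+ (z i).1.2 * (v i 0 == 1)%:R).
  have kvE : map_mx intr kv = sg v.
    apply/colP => i; rewrite !mxE intrM rmorphXn/= rmorphN1; congr (_ * _).
    by have [->|->] := v01 i; rewrite ?eqxx// eq_sym oner_eq0.
  have sqv : sqnorm (sg v) <= (2 * s)%:R.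
    rewrite sg_norm (le_trans _ sv)//; apply: ler_sum => i _.
    by have [->|->] := v01 i; rewrite ?expr0n ?expr1n.
  have := good kv; rewrite /= kvE => /(_ sv0) [].
    by apply: (le_trans sqv); rewrite natrM; lra.
  move=> _ /ltW/le_trans; apply.
  by rewrite natrM in sqv; nra.
have sqx : sqnorm x <= 49 * s%:R.
  apply: (@le_trans _ _ (sqnorm (h^-1 *: y))).
    apply: ler_sum => i _; rewrite !mxE mulrC; by have [] := zP i.
  by rewrite sqnormZ yE exprVn mulrCA mulVf ?mulr1// expf_neq0// gt_eqF.
have sqa : sqnorm a <= 2 * s%:R.
  rewrite -natrM (le_trans _ suma)//; apply: ler_sum => i _.
  by have /andP[? ?] := a01 i; rewrite expr2; nra.
have big : 30 * s%:R <= sqnorm x.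
  have : 49 * s%:R <= 4 / 3 * sqnorm x + 4 * sqnorm a.
    have -> : 49 * s%:R = sqnorm (x + sg a).
      apply: (mulIf (lt0r_neq0 (exprn_gt0 2 h0))); rewrite -yE yxa sqnormZ mulrC//.
    (* (u + v)^2 <= 4/3 u^2 + 4 v^2, because 0 <= (u - 3 v)^2 *)
    rewrite -(sg_norm a) /sqnorm !mulr_sumr -big_split/=; apply: ler_sum => i _.
    rewrite [(x + sg a) i 0]mxE; have := sqr_ge0 (x i 0 - 3 * sg a i 0); nra.
  lra.
have x0 : x != 0.
  apply: contraTneq big => ->; rewrite -ltNge /sqnorm big1.
    by rewrite mulr_gt0.
  by move=> i _; rewrite mxE expr0n.
have [+ _] := good k x0 sqx.
have -> : G *m x = - (G *m sg a).
  apply/eqP; rewrite -addr_eq0 -mulmxDr; apply/eqP.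
  have := Gy; rewrite yxa -scalemxAr => /eqP; rewrite scaler_eq0 gt_eqF//=.
  by move/eqP.
rewrite sqnormN; nra.
Qed.

(** A point of too large norm could be shrunk, keeping the hypotheses, until its
    norm takes the value excluded by [kernel_section_gap]. *)
Lemma kernel_section_radius n m (s : nat) (G : 'M[R]_(n, m)) (al h p : R)
    (x : 'cV[R]_m) :
  0 < al -> 0 < h -> 0 < p -> p <= 1 -> (0 < s)%N ->
  int_near_isometry G al (49 * s%:R) ->
  \sum_(i < m | (s <= i)%N) `|x i 0| `^ p <= s%:R * h `^ p ->
  G *m x = 0 -> sqnorm x <= 49 * s%:R * h ^+ 2.
Proof.
move=> al0 h0 p0 p1 s0 good tail Gx; rewrite leNgt; apply/negP => gt.
have r0 : 0 < 49 * s%:R * h ^+ 2 by rewrite !mulr_gt0 ?ltr0n// exprn_gt0.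
have sx0 : 0 < sqnorm x by exact: lt_trans gt.
pose t := Num.sqrt (49 * s%:R * h ^+ 2 / sqnorm x).
have t2 : t ^+ 2 = 49 * s%:R * h ^+ 2 / sqnorm x by rewrite sqr_sqrtr// divr_ge0// ltW.
have t0 : 0 <= t by exact: sqrtr_ge0.
have t1 : t <= 1.
  by rewrite -(@expr_le1 _ 2)// t2 ler_pdivrMr// mul1r ltW.
have : sqnorm (t *: x) != 49 * s%:R * h ^+ 2.
  apply: (kernel_section_gap al0 h0 p0 p1 s0 good); last first.
    by rewrite -scalemxAr Gx scaler0.
  apply: le_trans tail; apply: ler_sum => i _; rewrite mxE normrM ger0_norm//.
  apply: ge0_ler_powR; rewrite ?nnegrE ?mulr_ge0 ?(ltW p0)//.
  by rewrite ler_piMl.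
by rewrite sqnormZ t2 divfK ?eqxx// gt_eqF.
Qed.

Lemma ellipsoid_tail (p lambda : R) (m s : nat) (x : 'cV[R]_m) :
  0 < p -> 0 < lambda -> (0 < s)%N ->
  ellipsoid p (fun j : nat => j%:R `^ (- lambda)) m x ->
  \sum_(i < m | (s <= i)%N) `|x i 0| `^ p <=
    s%:R * (s%:R `^ (- (lambda + p^-1))) `^ p.
Proof.
move=> p0 l0 s0 xE.
have s0R : 0 < s%:R :> R by rewrite ltr0n.
have -> : s%:R * (s%:R `^ (- (lambda + p^-1))) `^ p = s%:R `^ (- (lambda * p)) :> R.
  rewrite -powRrM -[X in X * _]powRr1 ?(ltW s0R)// -powRD; last first.
    by rewrite (gt_eqF s0R) implybT.
  by congr (_ `^ _); field; rewrite gt_eqF.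
apply: (@le_trans _ _ (\sum_(i < m | (s <= i)%N)
    s%:R `^ (- (lambda * p)) * (`|x i 0| `^ p / (i.+1%:R `^ (- lambda)) `^ p))).
  apply: ler_sum => i si; rewrite mulrA ler_pdivlMr ?powR_gt0 ?ltr0n//.
  rewrite mulrC ler_wpM2r ?powR_ge0// -powRrM mulNr !powRN.
  rewrite lef_pV2 ?posrE ?powR_gt0 ?ltr0n//.
  apply: ge0_ler_powR; rewrite ?nnegrE ?mulr_ge0 ?(ltW p0) ?(ltW l0)//.
  by rewrite ler_nat leqW.
rewrite -mulr_sumr ler_piMr ?powR_ge0//.
apply: le_trans xE.
rewrite [leRHS](bigID (fun i : 'I_m => (s <= i)%N))/= lerDl.
by apply: sumr_ge0 => i _; rewrite divr_ge0// powR_ge0.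
Qed.

Lemma ellipsoid_section_radius n m (s : nat) (G : 'M[R]_(n, m))
    (al p lambda : R) (x : 'cV[R]_m) :
  0 < al -> 0 < p -> p <= 1 -> 0 < lambda -> (0 < s)%N ->
  int_near_isometry G al (49 * s%:R) ->
  ellipsoid p (fun j : nat => j%:R `^ (- lambda)) m x ->
  G *m x = 0 -> norm2 x <= 7 * s%:R `^ (- (lambda + 1 / p - 1 / 2)).
Proof.
move=> al0 p0 p1 l0 s0 good xE Gx.
have s0R : 0 < s%:R :> R by rewrite ltr0n.
have h0 : 0 < s%:R `^ (- (lambda + p^-1)) :> R by rewrite powR_gt0.
have := kernel_section_radius al0 h0 p0 p1 s0 good (ellipsoid_tail p0 l0 s0 xE) Gx.
rewrite -/(sqnorm x) => sx.
rewrite /norm2 -/(sqnorm x) -(@ler_sqr R) ?nnegrE ?sqrtr_ge0 ?mulr_ge0 ?powR_ge0//.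
rewrite sqr_sqrtr ?sqnorm_ge0// (le_trans sx)// exprMn -mulrA.
rewrite -!powR_mulrn ?powR_ge0// -!powRrM.
rewrite -[X in _ * (X * _)]powRr1 ?(ltW s0R)// -powRD; last first.
  by rewrite (gt_eqF s0R) implybT.
rewrite powR_mulrn// (_ : 7 ^+ 2 = 49); last by rewrite -natrX.
rewrite (_ : 1 + _ = - (lambda + 1 / p - 1 / 2) * 2)//.
by field; rewrite gt_eqF.
Qed.

End kernel_sections.

(** * Measurability of the event *)

Section topology.
Context {R : realType}.

Lemma continuous_norm_powR (p : R) : 0 < p ->
  continuous (fun x : R => `|x| `^ p).
Proof.
move=> p0 x; have [->|x0] := eqVneq x 0.
  apply/cvgrPdist_lt => e e0.
  have e'0 : 0 < e `^ p^-1 by rewrite powR_gt0.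
  have := @nbhs0_lt R R^o _ e'0; apply: filterS => t te.
  rewrite normr0 powR0 ?gt_eqF// sub0r normrN ger0_norm ?powR_ge0//.
  rewrite -[ltRHS]powRr1 ?(ltW e0)// -(@mulVf _ p) ?gt_eqF// powRrM.
  by apply: gt0_ltr_powR; rewrite ?nnegrE ?powR_ge0.
apply: (@continuous_comp R^o R^o R^o (fun u : R => `|u|) (fun u : R => u `^ p) x).
  exact: norm_continuous.
apply: differentiable_continuous; apply/derivable1_diffP.
by apply: derivable_powR; rewrite in_itv/= andbT normr_gt0.
Qed.

Lemma continuous_sum (V : topologicalType) (I : Type) (r : seq I)
    (f : I -> V -> R) : (forall i, continuous (f i)) ->
  continuous (fun y => \sum_(i <- r) f i y).
Proof.
move=> cf y.
apply: (@cvg_big R I +%R 0 xpredT (@add_continuous _) V (nbhs y) r f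
  (f^~ y)) => i _; exact: cf.
Qed.

Lemma continuous_sum_coord m (phi : R -> R) (c : 'I_m -> R) : continuous phi ->
  continuous (fun y : 'rV[R]_m => \sum_i phi (y 0 i) * c i).
Proof.
move=> cphi; apply: continuous_sum => i y.
have H : {for y, continuous (fun v : 'rV[R]_m => phi (v 0 i))}.
  apply: (@continuous_comp _ _ _ (fun v : 'rV[R]_m => v 0 i) phi).
    exact: coord_continuous.
  exact: cphi.
exact: (cvgM H (@cvg_cst _ _ _ _ _)).
Qed.

Lemma continuous_sqnorm_mul n m (G : 'M[R]_(n, m)) :
  continuous (fun y : 'rV[R]_m => sqnorm (G *m y^T)).
Proof.
have H i : continuous (fun y : 'rV[R]_m => (G *m y^T) i 0).
  rewrite (_ : (fun _ => _) = fun y : 'rV[R]_m => \sum_j G i j * y 0 j); last first.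
    by apply/funext => y; rewrite mxE; apply: eq_bigr => j _; rewrite mxE.
  apply: continuous_sum => j y.
  exact: (cvgM (@cvg_cst _ _ _ _ _) (@coord_continuous R _ _ 0 j y)).
rewrite (_ : (fun _ => _) =
  fun y : 'rV[R]_m => \sum_i (G *m y^T) i 0 * (G *m y^T) i 0); last first.
  by apply/funext => y; apply: eq_bigr => i _; rewrite expr2.
by apply: continuous_sum => i y; exact: (cvgM (H i y) (H i y)).
Qed.

Lemma rat_approx (x e : R) : 0 < e -> exists q : rat, `|x - ratr q| < e.
Proof.
move=> e0; have /rat_in_itvoo[q] : x - e < x + e by lra.
rewrite in_itv/= => /andP[q1 q2]; exists q.
by rewrite ltr_norml; apply/andP; split; lra.
Qed.

(** A point of K is chosen near each rational point, at each scale 1 / (i + 1) for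
    which there is one. *)
Lemma countable_dense_subset m (K : set 'rV[R]_m) : K !=set0 ->
  exists d : 'rV[rat]_m * nat -> 'rV[R]_m, (forall z, K (d z)) /\
    forall x, K x -> forall e : R, 0 < e -> exists z, ball x e (d z).
Proof.
move=> [x0 Kx0].
pose near_q (z : 'rV[rat]_m * nat) : set 'rV[R]_m :=
  [set x | K x /\ forall j, `|x 0 j - ratr (z.1 0 j)| < z.2.+1%:R^-1].
have ex z : exists y, K y /\ (near_q z !=set0 -> near_q z y).
  have [[y yz]|no] := pselect (near_q z !=set0); last by exists x0.
  by exists y; split => //; case: yz.
have [d dP] := choice ex; exists d; split => [z|x Kx e e0]; first by case: (dP z).
have [i ie] : exists i : nat, i.+1%:R^-1 + i.+1%:R^-1 < e.
  have e2 : 0 < e / 2 by rewrite divr_gt0.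
  have [i] := ltr_add_invr e2.
  by rewrite add0r => ie; exists i; rewrite [ltRHS]splitr; exact: ltrD.
have i0 : 0 < i.+1%:R^-1 :> R by rewrite invr_gt0.
have [q qP] := choice (fun j => rat_approx (x 0 j) i0).
exists (\row_j q j, i).
have [Kd /(_ _)[]] := dP (\row_j q j, i).
  by exists x; split => //= j; rewrite mxE.
move=> _ dq; split => // i' j; rewrite !ord1 /ball/=.
have := dq j; have := qP j; rewrite /= mxE => h1 h2.
rewrite (_ : x 0 j - _ =
  (x 0 j - ratr (q j)) - (d (\row_j q j, i) 0 j - ratr (q j))); last by ring.
by rewrite (le_lt_trans (ler_normB _ _))// (lt_trans _ ie)// ltrD.
Qed.

(** The continuous function y |-> |G y|^2 attains its minimum on K, hence it has a
    zero on K if and only if it takes arbitrarily small values on a countable dense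
    subset D of K. *)
Lemma measurable_kernel_meets_compact d (T : measurableType d)
    (P : probability T R) n m (g : 'I_n * 'I_m -> {RV P >-> R})
    (K : set 'rV[R]_m) :
  compact K -> measurable [set w | exists2 y, K y & gmx g w *m y^T = 0].
Proof.
move=> cK; have [->|/set0P K0] := eqVneq K set0.
  by rewrite (_ : [set w | _] = set0)//; apply/seteqP; split => // w [].
have [D [KD dense]] := countable_dense_subset K0.
pose F i z := [set w | sqnorm (gmx g w *m (D z)^T) < i.+1%:R^-1].
have -> : [set w | exists2 y, K y & gmx g w *m y^T = 0] =
    \bigcap_i \bigcup_z F i z.
  apply/seteqP; split => [w [y Ky Gy] i _|w wF].
    have cf := @continuous_sqnorm_mul _ _ (gmx g w) y.
    have : nbhs (sqnorm (gmx g w *m y^T)) [set u : R | u < i.+1%:R^-1].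
      have -> : sqnorm (gmx g w *m y^T) = 0.
        by rewrite Gy /sqnorm big1// => j _; rewrite mxE expr0n.
      by apply: lt_nbhsl; rewrite invr_gt0.
    move=> /cf/nbhs_ballP[e e0 /= be].
    by have [z yz] := dense y Ky e e0; exists z => //; exact: be.
  have cf : {within K, continuous (fun y : 'rV[R]_m => sqnorm (gmx g w *m y^T))}.
    by apply: continuous_subspaceT; exact: continuous_sqnorm_mul.
  have [y + ymin] := compact_EVT_min K0 cK cf; rewrite inE => Ky.
  exists y => //; apply/eqP; apply: contraT => Gy0.
  have [i] := ltr_add_invr (sqnorm_gt0 Gy0); rewrite add0r => iy.
  have [z _] := wF i I; rewrite /F/= => zi.
  have := ymin (D z); rewrite inE => /(_ (KD z)) /(lt_le_trans iy) /lt_trans /(_ zi).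
  by rewrite ltxx.
apply: bigcap_measurableType => i _.
apply: countable_bigcupT_measurable => // z.
rewrite (_ : F i z = (fun w => sqnorm (gmx g w *m (D z)^T)) @^-1`
  `]-oo, i.+1%:R^-1[%classic).
  by apply: preimage_measurable => //; exact: measurable_sqnorm_mul.
by apply/seteqP; split => w; rewrite /F/= in_itv.
Qed.

Lemma compact_ellipsoid_shell m (p lambda b : R) : 0 < p -> 0 < lambda ->
  compact [set y : 'rV[R]_m |
    ellipsoid p (fun j => j%:R `^ (- lambda)) m y^T /\ b <= sqnorm y^T].
Proof.
move=> p0 l0; apply: bounded_closed_compact.
  exists 1; split => // M M1 y [yE _]; rewrite /Num.norm/= mx_normrE.
  apply: bigmax_le => [|[i j] _]; first exact: le_trans (ltW M1).
  rewrite ord1 (le_trans _ (ltW M1))//= leNgt; apply/negP => yj.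
  have : 1 < `|y 0 j| `^ p.
    have := @gt0_ltr_powR R p p0 1 `|y 0 j|.
    by rewrite powR1; apply; rewrite ?nnegrE.
  apply/negP; rewrite -leNgt.
  apply: (@le_trans _ _ (`|y 0 j| `^ p / j.+1%:R `^ (- lambda) `^ p)).
    rewrite ler_pdivlMr ?powR_gt0// ler_piMr ?powR_ge0//.
    rewrite -powRrM mulNr powRN invf_le1 ?powR_gt0//.
    by rewrite -[leLHS](powRr0 j.+1%:R) ler_powR ?ler1n// mulr_ge0// ltW.
  apply: le_trans yE; rewrite (bigD1 j)//= mxE lerDl.
  by apply: sumr_ge0 => i' _; rewrite divr_ge0 ?powR_ge0.
apply: closedI.
  rewrite (_ : (fun _ => _) = (fun y : 'rV[R]_m => \sum_i
     `|y 0 i| `^ p * (i.+1%:R `^ (- lambda) `^ p)^-1) @^-1` [set u | u <= 1]).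
    apply: closed_comp; last exact: closed_le.
    move=> y _; apply: (continuous_sum_coord (phi := fun u => `|u| `^ p)).
    exact: continuous_norm_powR.
  apply/funext => y; rewrite /= /ellipsoid/=; congr (is_true (_ <= _)).
  by apply: eq_bigr => i _; rewrite mxE.
rewrite (_ : (fun _ => _) =
  (fun y : 'rV[R]_m => sqnorm (1%:M *m y^T)) @^-1` [set u | b <= u]).
  apply: closed_comp; last exact: closed_ge.
  by move=> y _; exact: continuous_sqnorm_mul.
by apply/seteqP; split => y; rewrite /= mul1mx.
Qed.

End topology.

(** * Random sections *)

Section sparsity.
Context {R : realType}.

(** The bound of [card_int_net] for N = 49 s has the exponent
    49 s * ln (1 / th) + 4 th m. With th = (ln 2 / 32) n / m the second term is
    (ln 2 / 8) n, and ln (1 / th) is at most A l for a constant A, so the same bound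
    for the first term determines s up to rounding. The hypothesis on n is what
    makes s positive after rounding down. *)
Lemma sparsity_level :
  exists c0 : R, 0 < c0 /\ forall m n : nat, (1 <= n)%N -> (n < m)%N ->
    let l := ln (expR 1 * m%:R / n%:R) in c0^-1 * l <= n%:R ->
    exists s : nat, exists th : R,
      [/\ (0 < s)%N, c0 / 2 * (n%:R / l) <= s%:R, 0 < l &
        [/\ 0 < th, th <= 1 / 2 &
        (49 * s)%:R * ln th^-1 + 4 * th * m%:R <= ln 2 / 4 * n%:R]].
Proof.
pose kap : R := ln 2 / 2.
have k0 : 0 < kap by rewrite divr_gt0// ln2_gt0.
have k1 : kap < 1.
  have : ln 2 < 2 :> R by exact: ln_sublinear.
  by rewrite /kap; lra.
pose A := 1 + ln (16 / kap).
have A1 : 1 <= A.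
  by rewrite lerDl ln_ge0// ler_pdivlMr// mul1r; lra.
pose c0 := kap / (196 * A).
have c00 : 0 < c0 by rewrite divr_gt0// mulr_gt0//; lra.
exists c0; split => // m n n1 nm l Dn.
have n0R : 0 < n%:R :> R by rewrite ltr0n.
have m0R : 0 < m%:R :> R by rewrite ltr0n (leq_trans _ nm).
have nmR : n%:R < m%:R :> R by rewrite ltr_nat.
have lE : l = 1 + ln (m%:R / n%:R).
  by rewrite /l -mulrA lnM ?posrE ?expR_gt0 ?divr_gt0// expRK.
have l1 : 1 <= l.
  by rewrite lE lerDl ln_ge0// ler_pdivlMr// mul1r ltW.
have l0 : 0 < l by lra.
pose q := c0 * n%:R / l.
have q1 : 1 <= q.
  by rewrite /q ler_pdivlMr// mul1r -ler_pdivrMl.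
have q0 : 0 <= q by lra.
have /andP[sq qs] := truncn_itv q0; set s := Num.truncn q in sq qs.
have s0 : (0 < s)%N by rewrite truncn_gt0.
have s1 : 1 <= s%:R :> R by rewrite ler1n.
pose th := kap * n%:R / (16 * m%:R).
have th0 : 0 < th by rewrite divr_gt0// mulr_gt0.
exists s, th; split => //.
  rewrite -natr1 in qs; rewrite (_ : c0 / 2 * (n%:R / l) = q / 2); first lra.
  by rewrite /q; field; rewrite gt_eqF.
split => //.
  rewrite /th ler_pdivrMr; last by rewrite mulr_gt0.
  by move: (kap) k0 k1 => k; nra.
have thV : ln th^-1 <= A * l.
  have -> : th^-1 = 16 / kap * (m%:R / n%:R).
    by rewrite /th; field; rewrite !gt_eqF.
  have kV : 0 < 16 / kap by exact: divr_gt0.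
  have mnV : 0 < m%:R / n%:R :> R by exact: divr_gt0.
  rewrite lnM// /A.
  have : 0 <= ln (16 / kap) by move: A1; rewrite /A; lra.
  rewrite lE in l1 *; move: (ln (16 / kap)) (ln (m%:R / n%:R)) l1 => a b; nra.
have -> : 4 * th * m%:R = kap / 4 * n%:R.
  by rewrite /th; field; rewrite gt_eqF.
have : (49 * s)%:R * ln th^-1 <= kap / 4 * n%:R.
  rewrite natrM; apply: (@le_trans _ _ (49 * q * (A * l))).
    rewrite (le_trans (ler_wpM2l _ thV)) ?mulr_ge0//.
    have A0 : 0 <= A by lra.
    by rewrite ler_wpM2r ?mulr_ge0 ?(ltW l0)// ler_wpM2l.
  rewrite /q /c0 le_eqVlt; apply/orP; left; apply/eqP.
  field; rewrite gt_eqF//= gt_eqF//; lra.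
rewrite /kap; lra.
Qed.

End sparsity.

Section random_section.
Context d (T : measurableType d) (R : realType) (P : probability T R).

Lemma l2_rad_le m (K : set 'cV[R]_m) (E : {vspace 'cV[R]_m}) (b : R) :
  (l2_rad K E <= b%:E)%E <-> forall x, K x -> x \in E -> norm2 x <= b.
Proof.
split=> [rb x Kx Ex|H].
  by rewrite -lee_fin; apply: le_trans rb; apply: ereal_sup_ubound; exists x.
by apply: ge_ereal_sup => _ [x [Kx Ex] <-]; rewrite lee_fin H.
Qed.

Lemma mem_random_kernel n m (g : 'I_n * 'I_m -> {RV P >-> R}) w x :
  (x \in random_kernel g w) = (gmx g w *m x == 0).
Proof. by rewrite memv_ker lfunE. Qed.

(** The norm exceeds b on the section if and only if the kernel meets, for some i,
    the compact part of the ellipsoid of norm at least b + 1 / (i + 1). *)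
Lemma measurable_l2_rad_event n m (g : 'I_n * 'I_m -> {RV P >-> R})
    (p lambda b : R) : 0 < p -> 0 < lambda -> 0 <= b ->
  measurable [set w | (l2_rad (ellipsoid p (fun j : nat => j%:R `^ (- lambda))%R m)
    (random_kernel g w) <= b%:E)%E].
Proof.
move=> p0 l0 b0; rewrite -[X in measurable X]setCK; apply: measurableC.
pose K i := [set y : 'rV[R]_m | ellipsoid p (fun j => j%:R `^ (- lambda)) m y^T /\
  (b + i.+1%:R^-1) ^+ 2 <= sqnorm y^T].
rewrite (_ : ~` _ = \bigcup_i [set w | exists2 y, K i y & gmx g w *m y^T = 0]).
  apply: bigcup_measurable => i _; apply: measurable_kernel_meets_compact.
  exact: compact_ellipsoid_shell.
have bi0 i : 0 <= b + i.+1%:R^-1 by rewrite addr_ge0.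
apply/seteqP; split => [w /= /l2_rad_le nH|w [i _ [y [yE yb] Gy]] /= /l2_rad_le H].
  apply: contra_notP nH => H x xE; rewrite mem_random_kernel => /eqP Gx.
  rewrite leNgt; apply/negP => /ltr_add_invr[i ix].
  apply: H; exists i => //; exists x^T; rewrite ?trmxK//; split; rewrite trmxK//.
  rewrite -[leRHS]sqr_sqrtr ?sqnorm_ge0// ler_sqr ?nnegrE ?sqrtr_ge0//.
  exact: ltW.
have := H y^T yE; rewrite mem_random_kernel Gy eqxx => /(_ isT); apply/negP.
rewrite -ltNge (@lt_le_trans _ _ (b + i.+1%:R^-1))//; first by rewrite ltrDl.
by rewrite -ler_sqr ?nnegrE ?sqrtr_ge0// sqr_sqrtr ?sqnorm_ge0.
Qed.

Lemma le_measure_bigsetU (I : Type) (r : seq I) (Q : pred I) (A : I -> set T) :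
  (forall i, measurable (A i)) ->
  (P (\big[setU/set0]_(i <- r | Q i) A i) <= \sum_(i <- r | Q i) P (A i))%E.
Proof.
move=> mA; elim: r => [|i r IH]; first by rewrite !big_nil measure0.
rewrite !big_cons; case: ifP => // _.
apply: le_trans (leeD2l _ IH); apply: measureU2 => //.
exact: bigsetU_measurable.
Qed.

Definition shrunk n m (g : 'I_n * 'I_m -> {RV P >-> R}) (k : 'cV[R]_m) : set T :=
  [set w | sqnorm (gmx g w *m k) <= ln 2 / 3 * n%:R * sqnorm k].

Definition stretched n m (g : 'I_n * 'I_m -> {RV P >-> R}) (k : 'cV[R]_m) : set T :=
  [set w | 4 * ln 2 * n%:R * sqnorm k <= sqnorm (gmx g w *m k)].

Lemma measurable_shrunk n m (g : 'I_n * 'I_m -> {RV P >-> R}) k :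
  measurable (shrunk g k).
Proof.
have mS := measurable_sqnorm_mul g k.
rewrite (_ : shrunk g k = (fun w => sqnorm (gmx g w *m k)) @^-1`
  `]-oo, (ln 2 / 3 * n%:R * sqnorm k)]%classic); first exact: preimage_measurable.
by apply/seteqP; split => w; rewrite /shrunk/= in_itv.
Qed.

Lemma measurable_stretched n m (g : 'I_n * 'I_m -> {RV P >-> R}) k :
  measurable (stretched g k).
Proof.
have mS := measurable_sqnorm_mul g k.
rewrite (_ : stretched g k = (fun w => sqnorm (gmx g w *m k)) @^-1`
  `[(4 * ln 2 * n%:R * sqnorm k), +oo[%classic); first exact: preimage_measurable.
by apply/seteqP; split => w; rewrite /stretched/= in_itv/= andbT.
Qed.

Definition distorted n m N (g : 'I_n * 'I_m -> {RV P >-> R}) : set T :=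
  \big[setU/set0]_(f in int_net m N | net_point f != 0 :> 'cV[R]_m)
    (shrunk g (net_point f) `|` stretched g (net_point f)).

Lemma measurable_distorted n m N (g : 'I_n * 'I_m -> {RV P >-> R}) :
  measurable (distorted N g).
Proof.
apply: bigsetU_measurable => f _; apply: measurableU.
  exact: measurable_shrunk.
exact: measurable_stretched.
Qed.

Lemma distorted_net n m N (g : 'I_n.+1 * 'I_m.+1 -> {RV P >-> R}) (th : R) :
  gaussian_matrix g -> 0 < th -> th <= 1 / 2 ->
  N%:R * ln th^-1 + 4 * th * m.+1%:R <= ln 2 / 4 * n.+1%:R ->
  (P (distorted N g) <= (2 * expR (- (ln 2 / 4 * n.+1%:R)))%:E)%E.
Proof.
move=> gg th0 th1 thN.
apply: (le_trans (le_measure_bigsetU _ _ _)) => [f|].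
  apply: measurableU; first exact: measurable_shrunk.
  exact: measurable_stretched.
set q : R := expR (- (ln 2 / 2 * n.+1%:R)).
apply: (@le_trans _ _ (\sum_(f in int_net m.+1 N) (2 * q)%:E)%E).
  rewrite big_mkcondr; apply: lee_sum => f _; case: ifPn => [f0|_]; last first.
    by rewrite lee_fin mulr_ge0// expR_ge0.
  have f0' := sqnorm_gt0 f0.
  have -> : 2 * q = q + q by ring.
  rewrite EFinD; apply: (le_trans (measureU2 _ _ _)).
  - exact: measurable_shrunk.
  - exact: measurable_stretched.
  by apply: leeD; [exact: sqnorm_gaussian_lower|exact: sqnorm_gaussian_upper].
rewrite sumEFin lee_fin sumr_const -[leLHS]mulr_natl.
apply: (@le_trans _ _ (expR (ln 2 / 4 * n.+1%:R) * (2 * q))).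
  rewrite ler_wpM2r ?mulr_ge0 ?expR_ge0//.
  by rewrite (le_trans (card_int_net _ _ th0 th1))// ler_expR.
rewrite mulrCA ler_wpM2l// -expRD ler_expR; lra.
Qed.

Lemma radius_outside_distorted n m s (g : 'I_n.+1 * 'I_m -> {RV P >-> R})
    (p lambda : R) w :
  0 < p -> p <= 1 -> 0 < lambda -> (0 < s)%N ->
  ~ distorted (49 * s) g w ->
  (l2_rad (ellipsoid p (fun j : nat => j%:R `^ (- lambda))%R m) (random_kernel g w)
    <= (7 * s%:R `^ (- (lambda + 1 / p - 1 / 2)))%:E)%E.
Proof.
move=> p0 p1 l0 s0 ndist; apply/l2_rad_le => x xE; rewrite mem_random_kernel => /eqP Gx.
have al0 : 0 < ln 2 / 3 * n.+1%:R :> R by rewrite mulr_gt0// divr_gt0// ln2_gt0.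
apply: (ellipsoid_section_radius al0 p0 p1 l0 s0 _ xE Gx) => k /= k0 kN.
rewrite -natrM in kN.
have [f fN fk] := int_net_surj kN.
have nd : ~ (shrunk g (net_point f) `|` stretched g (net_point f)) w.
  apply: contra_not ndist => wf; rewrite /distorted (bigD1 f)/=; first by left.
  by rewrite fN fk.
rewrite -fk; split; rewrite ltNge; apply/negP => h; apply: nd; [left|right] => //.
rewrite /stretched/= (le_trans _ h)// le_eqVlt; apply/orP; left; apply/eqP.
by field.
Qed.


End random_section.

Theorem theorem3p9 (R : realType) (p lambda : R)
    (p_gt0 : 0 < p) (p_le1 : p <= 1) (lambda_gt0 : 0 < lambda) :
  let sigma := fun j : nat => j%:R `^ (- lambda) : R in
  exists c C D : R, [/\ 0 < c, 0 < C, 0 < D &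
    forall m n : nat, (1 <= n)%N -> (n < m)%N ->
    D * ln (expR 1 * m%:R / n%:R) <= n%:R ->
    forall (d : measure_display) (T : measurableType d) (P : probability T R)
      (g : 'I_n * 'I_m -> {RV P >-> R}), gaussian_matrix g ->
    let bound := C * (ln (expR 1 * m%:R / n%:R) / n%:R)
                       `^ (lambda + 1 / p - 1 / 2) in
    let event :=
      [set w : T | (l2_rad (ellipsoid p sigma m) (random_kernel g w)
                       <= bound%:E)%E] in
    measurable event /\ ((1 - 2 * expR (- c * n%:R))%:E <= P event)%E].
Proof.
move=> sigma; have [c0 [c00 level]] := @sparsity_level R.
set beta := lambda + 1 / p - 1 / 2.
have beta0 : 0 < beta.
  have : 1 <= p^-1 by rewrite invf_ge1.
  rewrite /beta mul1r; lra.
exists (ln 2 / 4), (7 * (2 / c0) `^ beta), c0^-1; split.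
- by rewrite divr_gt0// ln2_gt0.
- by rewrite mulr_gt0// powR_gt0// divr_gt0.
- by rewrite invr_gt0.
move=> m n n1 nm Dn d T P g gg bound event.
have [s [th [s0 sn l0 [th0 th1 thN]]]] := level m n n1 nm Dn.
have n0R : 0 < n%:R :> R by rewrite ltr0n.
have mevent : measurable event.
  by apply: measurable_l2_rad_event => //; rewrite !mulr_ge0 ?powR_ge0.
split => //.
have s_bound : 7 * s%:R `^ (- beta) <= bound.
  rewrite /bound -mulrA ler_wpM2l// -powRM ?divr_ge0 ?(ltW l0)// ?(ltW c00)//.
  have -> : s%:R `^ (- beta) = s%:R^-1 `^ beta :> R.
    by rewrite -[in RHS]powR_inv1// -powRrM mulN1r.
  apply: ge0_ler_powR; rewrite ?nnegrE ?(ltW beta0)//.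
    by rewrite mulr_ge0 ?divr_ge0 ?(ltW l0) ?(ltW c00).
  have z1 : 0 < 2 / c0 by exact: divr_gt0.
  have z2 := divr_gt0 l0 n0R.
  rewrite -[leRHS]invrK lef_pV2 ?posrE ?invr_gt0 ?(mulr_gt0 z1 z2) ?ltr0n//.
  rewrite (le_trans _ sn)// le_eqVlt; apply/orP; left; apply/eqP.
  by field; rewrite !gt_eqF.
case: m n n1 nm Dn g gg @bound @event s0 sn l0 thN n0R mevent s_bound
  => [|m] [|n] // _ _ _ g gg bound event s0 _ _ thN _ mevent s_bound.
have sub : ~` event `<=` distorted (49 * s) g.
  move=> w; apply: contra_notP => nd; rewrite /event/=.
  apply: (le_trans (radius_outside_distorted p_gt0 p_le1 lambda_gt0 s0 nd)).
  by rewrite lee_fin.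
have PC : (P (~` event) <= (2 * expR (- (ln 2 / 4 * n.+1%:R)))%:E)%E.
  apply: le_trans (distorted_net gg th0 th1 thN); apply: le_measure => //; rewrite inE.
  - exact: measurableC.
  - exact: measurable_distorted.
have Pfin : P event \is a fin_num by exact: fin_num_measure.
move: PC; rewrite probability_setC// -(fineK Pfin) -EFinB !lee_fin mulNr; lra.
Qed.
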